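(* For all positive integers $n$, $$\mathtt{MCG}(\beta(n,n,\infty))=\Omega\left(\frac{\beta(n,n,\infty)}{n\log n}\right).$$
   Context: Directed multicut: given a directed graph $G=(V,E)$ and demand pairs $P\subseteq V\times V$, $\textsc{MCut}(G,P)$ is the minimum number of edges whose removal leaves no $s\leadsto t$ path for every $(s,t)\in P$. Maximum multicommodity flow: with unit capacity on every edge, choose for each $(s_i,t_i)\in P$ a flow from $s_i$ to $t_i$ (conserved at all other nodes) such that the sum of all flows on each edge is at most $1$; $\textsc{MMFlow}(G,P)$ is the maximum possible sum of the flow values. $\mathtt{MCG}(N)$ is the least integer $k$ such that for every $N$-node directed graph $G$ and every set of demand pairs $P$ (of any size), $\textsc{MCut}(G,P)\le k\cdot\textsc{MMFlow}(G,P)$. A path system is $S=(V,\Pi)$ with $V$ a finite set of nodes and $\Pi$ a multiset of node sequences (paths), each containing each node at most once; size $\|S\|=\sum_\pi|\pi|$ ($|\pi|$ = number of nodes). Write $x<_\pi y$ if $x$ strictly precedes $y$ in $\pi$. A $b$-bridge: $b$ distinct nodes $v_1,\dots,v_b$ and $b$ distinct paths $\pi_1,\dots,\pi_b$ with $v_i<_{\pi_i}v_{i+1}$ ($1\le i\le b-1$) and $v_1<_{\pi_b}v_b$. Bridge girth = least $b$ admitting a $b$-bridge ($\infty$ if none). $\beta(n,p,k)$ = maximum size of a path system with $n$ nodes, $p$ paths and bridge girth $>k$. *)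

(* Defs.v *)
From HB Require Import structures.
From mathcomp Require Import all_boot all_order all_algebra.
From mathcomp Require Import all_classical all_reals all_analysis.
Set Implicit Arguments. Unset Strict Implicit. Unset Printing Implicit Defensive.
Import Order.TTheory GRing.Theory Num.Theory.
Local Open Scope ring_scope.

(* An N-node directed graph: nodes 'I_N, edge set E : {set 'I_N * 'I_N}
   (an edge (x,y) goes from x to y).  Demand pairs P : {set 'I_N * 'I_N}. *)

Definition is_multicut (N : nat) (E P F : {set 'I_N * 'I_N}) : bool :=
  [forall p in P,
     ~~ connect [rel x y | (x, y) \in E :\: F] p.1 p.2].

(* MCut(G,P): the minimum number of edges of E forming a multicut
   (default #|E|; E itself is a multicut whenever all demand pairs have s <> t). *)
Definition MCut (N : nat) (E P : {set 'I_N * 'I_N}) : nat :=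
  \big[minn/#|E|]_(F : {set 'I_N * 'I_N} | (F \subset E) && is_multicut E P F) #|F|.

Definition outflow (R : realType) (N : nat) (g : 'I_N * 'I_N -> R) (v : 'I_N) : R :=
  \sum_(w : 'I_N) g (v, w).
Definition inflow (R : realType) (N : nat) (g : 'I_N * 'I_N -> R) (v : 'I_N) : R :=
  \sum_(w : 'I_N) g (w, v).

Definition flow_value (R : realType) (N : nat) (g : 'I_N * 'I_N -> R) (s : 'I_N) : R :=
  outflow g s - inflow g s.

Definition feasible_mcflow (R : realType) (N : nat) (E P : {set 'I_N * 'I_N})
    (f : 'I_N * 'I_N -> 'I_N * 'I_N -> R) : Prop :=
  [/\ (forall p e, 0 <= f p e),
      (forall p e, e \notin E -> f p e = 0),
      (forall p v, p \in P -> v != p.1 -> v != p.2 -> inflow (f p) v = outflow (f p) v),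
      (forall p, p \in P -> 0 <= flow_value (f p) p.1) &
      (forall e, e \in E -> \sum_(p in P) f p e <= 1)].

Definition MMFlow (R : realType) (N : nat) (E P : {set 'I_N * 'I_N}) : R :=
  sup [set v : R | exists f, feasible_mcflow E P f /\
                     v = \sum_(p in P) flow_value (f p) p.1].

Definition MCG_bound (R : realType) (N k : nat) : Prop :=
  forall (E P : {set 'I_N * 'I_N}),
    (forall p, p \in P -> p.1 != p.2) ->
    ((MCut E P)%:R : R) <= k%:R * MMFlow R E P.

(* MCG(N): the least such integer k (0 if none exists; it does exist). *)
Definition MCG (R : realType) (N : nat) : nat :=
  match pselect (exists k, `[< MCG_bound R N k >]) with
  | left h => ex_minn h
  | right _ => 0%N
  end.

(* A path system on n nodes: nodes 'I_n, paths Pi : seq (seq 'I_n) (a multiset,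
   the i-th path is nth [::] Pi i), each path without repeated nodes. *)
Definition path_system (n : nat) (Pi : seq (seq 'I_n)) : bool := all uniq Pi.

Definition ps_size (n : nat) (Pi : seq (seq 'I_n)) : nat := sumn (map size Pi).

Definition prec (n : nat) (pi : seq 'I_n) (x y : 'I_n) : bool :=
  [&& x \in pi, y \in pi & index x pi < index y pi]%N.

Definition has_bridge (n : nat) (Pi : seq (seq 'I_n)) (b : nat) : Prop :=
  (0 < b)%N /\
  exists (vs : nat -> 'I_n) (qs : nat -> nat),
    [/\ {in gtn b &, injective vs},
        {in gtn b &, injective qs},
        (forall i, (i < b)%N -> (qs i < size Pi)%N),
        (forall i, (i.+1 < b)%N -> prec (nth [::] Pi (qs i)) (vs i) (vs i.+1)) &
        prec (nth [::] Pi (qs b.-1)) (vs 0%N) (vs b.-1)].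

(* bridge girth > k, where k = None stands for infinity *)
Definition girth_gt (n : nat) (Pi : seq (seq 'I_n)) (k : option nat) : Prop :=
  forall b, (if k is Some k' then (b <= k')%N else true) -> ~ has_bridge Pi b.

(* beta(n,p,k): maximum size of a path system with n nodes, p paths and bridge
   girth > k.  Every path has at most n nodes, so the size is at most n*p and
   the maximum may be taken over 0..n*p. *)
Definition beta (n p : nat) (k : option nat) : nat :=
  \max_(s < (n * p).+1 |
          `[< exists Pi : seq (seq 'I_n),
                [/\ path_system Pi, size Pi = p, girth_gt Pi k & ps_size Pi = s] >])
    (s : nat).

(* Main.v *)
(** Take an extremal bridge-free system.  A dyadic class of long paths carries a
    1/log n fraction of its size.  Sampling a random colour class of nodes and
    shortening the paths makes the paths plentiful compared to the nodes, and deleting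
    few incidences then yields a subsystem whose nodes carry a function increasing
    along every path.  In such an ordered bridge-free system, a walk whose endpoints
    lie in this order on one path [i] can only use edges of [i].

    The network has one unit-capacity node per incidence (node, path).  For every
    path [i], each incidence receives a random level below [T]; there is an arc from one
    incidence to another if for some [i] their nodes are consecutive levels in the order
    of [i], and a demand from level [0] to level [T - 1].  Walks realising a demand
    of [i] stay on [i] and so have length at least [T], which bounds the flow by
    (number of incidences) / [T].  On the other hand, for a suitable choice of the
    levels no removal of 1/16 of the incidences cuts all the demands: a union bound
    over the removed sets works since every node has many incidences, so that along a
    path most nodes still offer the next level. *)

Require Import Defs.
From HB Require Import structures.
From mathcomp Require Import all_boot all_order all_algebra.
From mathcomp Require Import zify ring lra.
Set Implicit Arguments. Unset Strict Implicit. Unset Printing Implicit Defensive.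

(** * Bridges and walks *)

Lemma prec_subseq n (s : seq 'I_n) x y : uniq s -> prec s x y = subseq [:: x; y] s.
Proof.
rewrite /prec; elim: s => [|z s IH] //= /andP[zs us].
rewrite !inE (eq_sym z x) (eq_sym z y); have [->|nxz] := eqVneq x z.
  rewrite /= sub1seq; have [->|nyz] := eqVneq y z; first by rewrite (negbTE zs).
  by rewrite /= ltn0Sn andbT.
have [->|nyz] := eqVneq y z; first last.
  by rewrite /= ltnS IH.
rewrite /= ltn0 !andbF; symmetry; apply: contraNF zs => /mem_subseq; apply.
by rewrite !inE eqxx orbT.
Qed.

Lemma subseq_prec n (s1 s2 : seq 'I_n) x y :
  uniq s2 -> subseq s1 s2 -> prec s1 x y -> prec s2 x y.
Proof.
move=> us2 s12; rewrite !prec_subseq ?(subseq_uniq s12) // => /subseq_trans; exact.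
Qed.

Lemma prec_take_drop n (s : seq 'I_n) c x y :
  uniq s -> x \in take c s -> y \in drop c s -> prec s x y.
Proof.
move=> us xs ys; rewrite prec_subseq // -(cat_take_drop c s) -[[:: x; y]]/([:: x] ++ [:: y]).
by apply: cat_subseq; rewrite sub1seq.
Qed.

Section Walk.
Variables (I V : eqType).

(* An item [(i, y)] of a walk is a step to [y] along an edge of colour [i]. *)
Fixpoint walk (E : I -> rel V) (x : V) (s : seq (I * V)) : bool :=
  if s is iy :: s' then E iy.1 x iy.2 && walk E iy.2 s' else true.

Definition wlast (x : V) (s : seq (I * V)) := last x (unzip2 s).

Lemma walk_cat E x s1 s2 : walk E x (s1 ++ s2) = walk E x s1 && walk E (wlast x s1) s2.
Proof. by elim: s1 x => [|[i y] s1 IH] x //=; rewrite IH andbA. Qed.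

Lemma wlast_cat x s1 s2 : wlast x (s1 ++ s2) = wlast (wlast x s1) s2.
Proof. by rewrite /wlast /unzip2 map_cat last_cat. Qed.

Lemma sub_walk (E E' : I -> rel V) x s :
  (forall i x y, E i x y -> E' i x y) -> walk E x s -> walk E' x s.
Proof. by move=> EE'; elim: s x => [|[i y] s IH] x //= /andP[/EE'-> /IH]. Qed.

Lemma wlast_take x s k : k <= size s -> wlast x (take k s) = nth x (x :: unzip2 s) k.
Proof.
elim: s x k => [|[i y] s IH] x [|k] //= ks.
rewrite -[wlast _ _]/(wlast y (take k s)) IH //.
by apply: set_nth_default; rewrite /= size_map ltnS.
Qed.

Lemma walk_nth E i0 x s k : walk E x s -> k < size s ->
  E (nth i0 (unzip1 s) k) (nth x (x :: unzip2 s) k) (nth x (x :: unzip2 s) k.+1).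
Proof.
elim: s x k => [|[i y] s IH] x [|k] //= /andP[Exy w] ks //.
have dflt m : m < (size s).+1 -> nth x (y :: unzip2 s) m = nth y (y :: unzip2 s) m.
  by move=> ms; apply: set_nth_default; rewrite /= size_map.
by rewrite (dflt k) 1?ltnW // -[nth x (unzip2 s) k]/(nth x (y :: unzip2 s) k.+1) dflt //; apply: IH.
Qed.

End Walk.

(** A bridge read as a coloured walk: [s] supplies all nodes but the first and all paths but the
    last, and [i] closes the bridge. An arbitrary index type lets subfamilies inherit the property
    along an injection. *)
Definition bridge_free (n : nat) (I : eqType) (pi : I -> seq 'I_n) : Prop :=
  forall i x (s : seq (I * 'I_n)), uniq (x :: unzip2 s) -> uniq (i :: unzip1 s) ->
    walk (fun j => prec (pi j)) x s -> ~~ prec (pi i) x (wlast x s).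

Lemma bridge_free_sub n (I J : eqType) (pi : I -> seq 'I_n) (pi' : J -> seq 'I_n) (f : J -> I) :
  injective f -> (forall i, uniq (pi i)) -> (forall j, subseq (pi' j) (pi (f j))) ->
  bridge_free pi -> bridge_free pi'.
Proof.
move=> finj upi sub bf i x s us ui w; apply/negP => pr.
have H2 : unzip2 [seq (f p.1, p.2) | p <- s] = unzip2 s by rewrite /unzip2 -map_comp.
have H1 : unzip1 [seq (f p.1, p.2) | p <- s] = map f (unzip1 s).
  by rewrite /unzip1 -!map_comp.
have := bf (f i) x [seq (f p.1, p.2) | p <- s].
rewrite /wlast H2 H1 => /(_ us); rewrite -map_cons map_inj_uniq // => /(_ ui).
move=> /(_ _)/negP[]; last exact: subseq_prec (sub i) pr.
elim: s x {us ui pr H1 H2} w => [|[j y] s IH] x //= /andP[pxy w].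
by rewrite (subseq_prec _ (sub j) pxy) //= IH.
Qed.

Lemma girth_bridge_free n (Pi : seq (seq 'I_n)) :
  girth_gt Pi None -> bridge_free (fun i : 'I_(size Pi) => nth [::] Pi i).
Proof.
move=> girth i x s us ui w; apply/negP => pr.
apply: (girth (size s).+1) => //; split=> //.
have u1 : uniq (rcons (map val (unzip1 s)) (val i)).
  by rewrite -map_rcons (map_inj_uniq val_inj) rcons_uniq -cons_uniq.
have sz1 : size (unzip1 s) = size s by rewrite size_map.
have sz2 : size (unzip2 s) = size s by rewrite size_map.
have szr : size (rcons (map val (unzip1 s)) (val i)) = (size s).+1.
  by rewrite size_rcons size_map sz1.
exists (nth x (x :: unzip2 s)), (nth 0 (rcons (map val (unzip1 s)) (val i))); split.
- move=> a b; rewrite !inE => ha hb /eqP; rewrite nth_uniq //=; last by rewrite sz2.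
    by move/eqP.
  by rewrite sz2.
- move=> a b; rewrite !inE => ha hb /eqP; rewrite nth_uniq ?szr //; by move/eqP.
- move=> a ha; have : nth 0 (rcons (map val (unzip1 s)) (val i)) a \in
    rcons (map val (unzip1 s)) (val i) by rewrite mem_nth // szr.
  rewrite mem_rcons inE => /orP[/eqP->|/mapP[j _ ->]]; exact: ltn_ord.
- move=> a ha; rewrite nth_rcons size_map sz1 -ltnS ha.
  rewrite (nth_map i) ?sz1 -1?ltnS //.
  by apply: (@walk_nth _ _ (fun j : 'I_(size Pi) => prec (nth [::] Pi j))); rewrite -1?ltnS.
- rewrite [_.-1]/= nth_rcons size_map sz1 ltnn eqxx.
  by rewrite -(@wlast_take _ _ x s (size s)) // take_oversize.
Qed.

Section WalkBridge.
Variables (n : nat) (I : eqType) (pi : I -> seq 'I_n) (E : I -> rel 'I_n).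
Hypothesis bf : bridge_free pi.
Hypothesis HE : forall i x y, E i x y -> prec (pi i) x y.
Hypothesis shortcut : forall i (x y : 'I_n) (s : seq (I * 'I_n)) y', E i x y -> walk E y s ->
  E i (wlast y s) y' -> E i x y'.

(** Induction on the length. At a repeated node the closed part of the walk is cut out; at a
    repeated colour [shortcut] merges the two edges of that colour and drops everything between. A
    walk with neither repetition falls under [bridge_free]. *)
Lemma walk_bridge (i : I) (x : 'I_n) (s : seq (I * 'I_n)) :
  walk E x s -> i \notin unzip1 s -> ~~ prec (pi i) x (wlast x s).
Proof.
have [m] := ubnP (size s); elim: m s => // m IH s; rewrite ltnS => sm w is_.
have subI (s' : seq (I * 'I_n)) : {subset unzip1 s' <= unzip1 s} -> i \notin unzip1 s'.
  by move=> sub; apply: contra is_ => /sub.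
have [us|] := boolP (uniq (x :: unzip2 s)); last first.
  case/(uniqPn x) => a [b] []; rewrite /= size_map ltnS => ab bs.
  rewrite -!wlast_take // 1?(leq_trans (ltnW ab)) // => eqab.
  have eq_l : wlast x (take a s ++ drop b s) = wlast x s.
    by rewrite wlast_cat eqab -wlast_cat cat_take_drop.
  rewrite -eq_l; apply: IH.
  - rewrite size_cat size_takel 1?(leq_trans (ltnW ab)) // size_drop.
    by move: ab bs sm; move: (size s) => k; clear; lia.
  - have w1 : walk E x (take a s) by move: w; rewrite -{1}(cat_take_drop a s) walk_cat => /andP[].
    rewrite walk_cat w1 eqab /=.
    by move: w; rewrite -{1}(cat_take_drop b s) walk_cat => /andP[].
  - apply: subI => j; rewrite /unzip1 map_cat mem_cat map_take map_drop.
    by case/orP => [/mem_take|/mem_drop].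
have [ui|] := boolP (uniq (unzip1 s)).
  by apply: bf => //=; rewrite ?is_ // ?ui //; apply: sub_walk w.
case/(uniqPn i) => a [b] []; rewrite size_map => ab bs.
pose p0 : I * 'I_n := (i, x).
rewrite !(nth_map p0) ?(ltn_trans ab) // => eqab.
have as_ : a < size s by exact: ltn_trans ab bs.
pose s1 := take a s; pose s2 := drop a.+1 (take b s); pose s3 := drop b.+1 s.
have es : s = s1 ++ (nth p0 s a) :: s2 ++ nth p0 s b :: s3.
  rewrite /s1 /s2 /s3 -(drop_nth p0 bs).
  rewrite -{1}(cat_take_drop a s); congr cat; rewrite (drop_nth p0 as_); congr cons.
  have szb : size (take b s) = b by rewrite size_takel // ltnW.
  rewrite -{1}(cat_take_drop b s) drop_cat szb.
  case: ltnP => // ba; have ->: a.+1 = b by apply/eqP; rewrite eqn_leq ab.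
  by rewrite subnn drop0 [drop b (take b s)]drop_oversize ?szb.
move: (nth p0 s a) (nth p0 s b) eqab es => [k y] [k' y'] /= <- es.
move: w; rewrite es walk_cat /= walk_cat /= => /and5P[w1 Exy w2 Exy' w3].
have -> : wlast x (s1 ++ (k, y) :: s2 ++ (k, y') :: s3) = wlast x (s1 ++ (k, y') :: s3).
  by rewrite -cat_cons catA !wlast_cat.
apply: IH.
- apply: leq_trans sm; rewrite es !size_cat /= !size_cat /=.
  by move: (size s1) (size s2) (size s3) => k1 k2 k3; clear; lia.
- by rewrite walk_cat w1 /= w3 andbT; apply: shortcut Exy w2 Exy'.
- apply: subI => j; rewrite es /unzip1 !map_cat /= !map_cat /= !mem_cat !inE !mem_cat !inE.
  by case/or3P => -> //; rewrite ?orbT.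
Qed.

Lemma connect_walk (F : rel 'I_n) x y :
  (forall a b, F a b -> exists i, E i a b) -> connect F x y ->
  exists2 s : seq (I * 'I_n), walk E x s & wlast x s = y.
Proof.
move=> FE /connectP[p]; elim: p x => [|z p IH] x /=; first by move=> _ ->; exists [::].
case/andP => /FE[i Exz] /IH{}IH /IH[s ws ls]; exists ((i, z) :: s) => //=.
by rewrite Exz.
Qed.

End WalkBridge.

(** * Averaging *)

Lemma connect_cross (V : finType) (e : rel V) (Q : {set V}) x y :
  connect e x y -> x \in Q -> y \notin Q -> exists a b, [/\ a \in Q, b \notin Q & e a b].
Proof.
case/connectP=> p; elim: p x => [|z p IH] x /=; first by move=> _ -> ->.
case/andP=> exz pz ly xQ yQ; have [zQ|zQ] := boolP (z \in Q); first exact: IH pz ly zQ yQ.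
by exists x, z.
Qed.

(** A spanning forest of the classes of [rt] is grown from the roots. Each new node spends at most
    one new colour, charged to the node itself, which lies in [U] as the head of an edge. *)
Lemma connect_tree (V I : finType) (E : I -> rel V) (U : {set V}) (rt : V -> V) :
  (forall i x y, E i x y -> y \in U) -> (forall x, rt (rt x) = rt x) ->
  (forall x, connect [rel a b | (rt a == rt b) && [exists i, E i a b]] (rt x) x) ->
  exists2 Tr : {set I}, #|Tr| <= #|U| &
    forall x, connect [rel a b | [exists i in Tr, E i a b]] (rt x) x.
Proof.
move=> EU rtK con.
(* [Q] holds the nodes already joined to their roots and [Tr] the colours spent so far; the
   induction is on the number of nodes outside [Q]. *)
suff grow k (Q : {set V}) (Tr : {set I}) : #|~: Q| <= k -> (forall x, rt x \in Q) ->
    (forall x, x \in Q -> connect [rel a b | [exists i in Tr, E i a b]] (rt x) x) ->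
    #|Tr| <= #|U :&: Q| ->
  exists2 Tr' : {set I}, #|Tr'| <= #|U| &
    forall x, connect [rel a b | [exists i in Tr', E i a b]] (rt x) x.
  apply: (grow _ [set x | rt x == x] set0 (leqnn _)).
  - by move=> x; rewrite inE rtK.
  - by move=> x; rewrite inE => /eqP->; exact: connect0.
  - by rewrite cards0.
elim: k Q Tr => [|k IH] Q Tr.
  rewrite leqn0 cards_eq0 => /eqP Q0 _ cQ cT; exists Tr.
    by apply: leq_trans cT (subset_leq_card (subsetIl _ _)).
  by move=> x; apply: cQ; have := in_set0 x; rewrite -Q0 inE => /negbFE.
move=> cQ rQ coQ cT; have [/eqP Q0|] := boolP (~: Q == set0).
  by apply: (IH Q Tr) => //; rewrite Q0 cards0.
case/set0Pn=> x; rewrite inE => xQ.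
have [a [b [aQ bQ /andP[/eqP rab /existsP[i Eab]]]]] := connect_cross (con x) (rQ x) xQ.
apply: (IH (b |: Q) (i |: Tr)).
- rewrite -ltnS; apply: leq_trans cQ; apply: proper_card; apply/properP; split.
    by apply/subsetP=> y; rewrite !inE negb_or => /andP[].
  by exists b; rewrite !inE ?eqxx.
- by move=> y; rewrite inE rQ orbT.
- have mono y z : connect [rel a b | [exists i in Tr, E i a b]] y z ->
      connect [rel a b | [exists j in i |: Tr, E j a b]] y z.
    apply: connect_sub => u v /existsP[j /andP[jT Ej]]; apply: connect1.
    by apply/existsP; exists j; rewrite inE jT orbT.
  move=> y /setU1P[->|yQ]; last by apply: mono; apply: coQ.
  rewrite -rab; apply: connect_trans (mono _ _ (coQ _ aQ)) _; apply: connect1.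
  by apply/existsP; exists i; rewrite !inE eqxx.
- have bU : b \in U := EU _ _ _ Eab.
  apply: leq_trans (leq_card_setU _ _) _; rewrite cards1.
  rewrite (cardsD1 b (U :&: (b |: Q))) !inE bU eqxx /= leq_add2l.
  apply: leq_trans cT (subset_leq_card _); apply/subsetP=> y; rewrite !inE.
  by case/andP=> -> yQ; rewrite yQ orbT !andbT; apply: contraNneq bQ => <-.
Qed.

Lemma exists_le_average (C : finType) (f : C -> nat) (c0 : C) b :
  \sum_(c : C) f c <= #|C| * b -> exists c, f c <= b.
Proof.
move=> H; apply/existsP; apply: contraLR H; rewrite negb_exists -ltnNge => /forallP H.
have : \sum_(c : C) b.+1 <= \sum_(c : C) f c.
  by apply: leq_sum => c _; rewrite ltnNge.
rewrite sum_nat_const; apply: leq_trans.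
by rewrite ltn_pmul2l //; apply/card_gt0P; exists c0.
Qed.

Section Resample.
Variables (I T : finType).

Definition upd (c : {ffun I -> T}) j t := [ffun i => if i == j then t else c i].

(* Resampling the coordinate [j] is measure preserving: [(c, t) |-> (upd c j t, c j)]
   is an involution. *)
Lemma resample j (f : {ffun I -> T} -> T -> nat) :
  (forall c t u, f (upd c j t) u = f c u) ->
  \sum_c \sum_t f c t = #|T| * \sum_c f c (c j).
Proof.
move=> fu; pose h (ct : {ffun I -> T} * T) := (upd ct.1 j ct.2, ct.1 j).
have hK : involutive h.
  move=> [c t]; rewrite /h /= !ffunE eqxx; congr (_, _).
  by apply/ffunP=> i; rewrite !ffunE; case: eqP => // ->.
rewrite pair_big /= (reindex_inj (inv_inj hK)) /=.
rewrite -(pair_big predT predT (fun c t => f (upd c j t) (c j))) /= big_distrr /=.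
apply: eq_bigr => c _; under eq_bigr do rewrite fu.
by rewrite sum_nat_const.
Qed.

End Resample.

(** * Sampling nodes *)

(** [U] is a class of a random colouring with [K] colours. A path meets a class in [L] nodes on
    average, and a second moment bound shows that truncating these counts at [L] costs only a
    constant factor. *)
Lemma sample_nodes (n K L : nat) (I : finType) (pi : I -> seq 'I_n) :
  0 < K -> 0 < L -> (forall i, uniq (pi i)) -> (forall i, size (pi i) = K * L) ->
  28 * n <= K * #|I| ->
  exists U : {set 'I_n},
    #|I| * L + 28 * L * #|U| <= 4 * \sum_i minn (count (mem U) (pi i)) L.
Proof.
case: K => // K _ L0 upi szpi hK; set k := K.+1 in szpi hK *; pose q := #|I|.
have cst (m : nat) (s : seq 'I_n) : \sum_(x <- s) m = size s * m.
  by rewrite big_const_seq count_predT iter_addn_0 mulnC.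
(* [Q] counts monochromatic ordered pairs on the paths. Its mean is at most the number of diagonal
   pairs plus a fraction [1/k] of all pairs. *)
pose Q (chi : {ffun 'I_n -> 'I_k}) :=
  \sum_i \sum_(x <- pi i) \sum_(y <- pi i) (chi x == chi y).
have pair_eq x y : k * \sum_(chi : {ffun 'I_n -> 'I_k}) (chi x == chi y) <=
    #|{ffun 'I_n -> 'I_k}| * (k * (y == x) + 1).
  have [->|nyx] := eqVneq y x.
    under eq_bigr do rewrite eqxx.
    by rewrite sum_nat_const muln1 mulnC leq_mul2l; apply/orP; right; rewrite muln1 leq_addr.
  have := @resample _ _ x (fun (chi : {ffun 'I_n -> 'I_k}) t => (t == chi y) : nat).
  rewrite card_ord => <-; last by move=> c t u; rewrite ffunE (negbTE nyx).
  rewrite muln0 add0n muln1 -sum1_card; apply: leq_sum => c _.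
  by rewrite (bigD1 (c y)) //= eqxx big1 // => t /negbTE->.
have [chi Hchi] : exists chi, Q chi <= q * (k * L + k * L * L).
  apply: (exists_le_average [ffun=> ord0]).
  rewrite -(leq_pmul2l (ltn0Sn K)) -/k /Q exchange_big /= big_distrr /=.
  apply: (@leq_trans (\sum_(i : I) #|{ffun 'I_n -> 'I_k}| * (k * (k * L) + k * L * (k * L)))).
    apply: leq_sum => i _; rewrite exchange_big /= big_distrr /=.
    have -> : #|{ffun 'I_n -> 'I_k}| * (k * (k * L) + k * L * (k * L)) =
        \sum_(x <- pi i) (#|{ffun 'I_n -> 'I_k}| * (k + size (pi i))).
      by rewrite cst szpi [RHS]mulnCA; congr (_ * _); rewrite [RHS]mulnDr (mulnC k (k * L)).
    apply: leq_sum => x _; rewrite exchange_big /= big_distrr /=.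
    apply: (@leq_trans (\sum_(y <- pi i) #|{ffun 'I_n -> 'I_k}| * (k * (y == x) + 1))).
      by apply: leq_sum => y _; exact: pair_eq.
    rewrite -big_distrr /= leq_mul2l big_split /= sum1_size leq_add2r -big_distrr /=.
    apply/orP; right; rewrite -[X in _ <= X]muln1 leq_mul2l /=.
    rewrite -big_mkcond /= sum1_count (eq_count (a2 := pred1 x)) // count_uniq_mem //.
    exact: leq_b1.
  rewrite sum_nat_const -/q; nia.
pose X i (b : 'I_k) := count (fun x => chi x == b) (pi i).
have X1 i : \sum_b X i b = k * L.
  rewrite -(szpi i) /X -sum1_size; under eq_bigr do rewrite -sum1_count big_mkcond /=.
  rewrite exchange_big /=; apply: eq_bigr => x _.
  by rewrite (bigD1 (chi x)) //= eqxx big1 // => t; rewrite eq_sym => /negbTE->.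
have X2 : \sum_i \sum_b X i b * X i b = Q chi.
  apply: eq_bigr => i _.
  under eq_bigr => b _ do rewrite {1}/X -sum1_count big_mkcond /= big_distrl /=.
  rewrite exchange_big /=; apply: eq_bigr => x _.
  rewrite (bigD1 (chi x)) //= eqxx mul1n big1 ?addn0; last first.
    by move=> t; rewrite eq_sym => /negbTE->.
  rewrite /X -sum1_count big_mkcond /=; apply: eq_bigr => y _.
  by rewrite eq_sym; case: eqP.
pose S := \sum_b \sum_i minn (X i b) L.
(* Rests on [4 L x <= 4 L min(x, L) + x^2], which is [(x - 2 L)^2 >= 0] when [x] is at least [L],
   summed over all counts [x = X i b]. *)
have HS : q * k * L <= 2 * S.
  have H : 4 * L * (q * (k * L)) <= 4 * L * S + Q chi.
    rewrite -X2 /S exchange_big /= big_distrr /= -big_split /=.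
    rewrite /q -sum_nat_const big_distrr /=; apply: leq_sum => i _.
    rewrite -(X1 i) !big_distrr /= -big_split /=; apply: leq_sum => b _.
    rewrite /minn; case: ltnP => // Lx; first exact: leq_addr.
    by have := (nat_Cauchy (X i b) (2 * L)).1; rewrite -!mulnn; move: (X i b) => z; clear; nia.
  have kL : k * L <= k * L * L by rewrite leq_pmulr.
  have : 4 * L * (q * (k * L)) <= 4 * L * S + q * (k * L * L) * 2.
    apply: leq_trans H _; rewrite leq_add2l; apply: leq_trans Hchi _.
    by rewrite -[X in _ <= X]mulnA leq_mul2l; apply/orP; right; rewrite muln2 -addnn leq_add2r.
  have L2 : 0 < 2 * L by rewrite muln_gt0.
  move=> H'; rewrite -(leq_pmul2l L2); move: H'; move: (k) (q) (S); clear => k q S; nia.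
(* The classes partition the nodes, so summing the left side over [b] gives [k q L + 28 L n], at
   most [2 k q L] and hence at most [4 S]. *)
have /existsP[b Hb] : [exists b, q * L + 28 * L * #|[set x | chi x == b]| <=
    4 * \sum_i minn (X i b) L].
  apply: contraT; rewrite negb_exists => /forallP Hb.
  have : \sum_(b < k) (4 * \sum_i minn (X i b) L).+1 <=
     \sum_(b < k) (q * L + 28 * L * #|[set x | chi x == b]|).
    by apply: leq_sum => b _; rewrite ltnNge.
  rewrite big_split /= sum_nat_const card_ord -big_distrr /=.
  have -> : \sum_(b < k) #|[set x | chi x == b]| = n.
    rewrite -[RHS](card_ord n) -[RHS]sum1_card.
    rewrite (eq_bigr (fun b => \sum_(x : 'I_n) (chi x == b))); last first.
      by move=> b _; rewrite -sum1_card big_mkcond; apply: eq_bigr => x _; rewrite inE; case: eqP.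
    rewrite exchange_big /=; apply: eq_bigr => x _.
    by rewrite (bigD1 (chi x)) //= eqxx big1 // => b; rewrite eq_sym => /negbTE->.
  under eq_bigr do rewrite -addn1.
  rewrite big_split /= sum_nat_const card_ord muln1 -big_distrr /= -/S.
  have : 28 * L * n <= L * (k * q) by rewrite -mulnA mulnCA leq_mul2l hK orbT.
  move: HS; rewrite /k; move: (K) (S) (q) (n); clear => K S q n; nia.
exists [set x | chi x == b]; apply: leq_trans Hb _; rewrite leq_mul2l /=.
apply: leq_sum => i _; rewrite /X (eq_count (a2 := mem [set x | chi x == b])) //.
by move=> x; rewrite /= inE.
Qed.

(** * Passing to an ordered subsystem *)

Section Cuts.
Variables (n : nat) (I : finType) (pi : I -> seq 'I_n) (L : nat) (U : {set 'I_n}).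
Hypothesis upi : forall i, uniq (pi i).
Hypothesis bf : bridge_free pi.
Hypothesis piU : forall i, {subset pi i <= U}.

Implicit Types (c : {ffun I -> 'I_L.+1}) (Z : {set I}).

(* The cut position [c i] of path [i] is chosen at random, and [rank] below orders the
   nodes by longest chains in the union of the cuts that lie on no cycle.  Only [3 #|U|]
   paths influence the rank or violate it at their own cut, so after resampling [c j] the
   expected number of violations at a uniform position is at most [3 #|U|] in total. *)
Definition cutE c (i : I) : rel 'I_n :=
  fun x y => (x \in take (c i) (pi i)) && (y \in drop (c i) (pi i)).

Definition cutrel c : rel 'I_n := fun x y => [exists i, cutE c i x y].

(** Cutting at position 0 leaves nothing on the left, so the paths in [Z] contribute no edge. *)
Definition off Z c : {ffun I -> 'I_L.+1} := [ffun i => if i \in Z then ord0 else c i].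

Lemma cutE_off Z c i x y : cutE (off Z c) i x y = (i \notin Z) && cutE c i x y.
Proof. by rewrite /cutE /off ffunE; case: (i \in Z); rewrite // take0. Qed.

Lemma off_off Z W c : off Z (off W c) = off (Z :|: W) c.
Proof. by apply/ffunP=> i; rewrite !ffunE inE; case: (i \in Z). Qed.

Lemma cutrel_off Z c x y : cutrel (off Z c) x y -> cutrel c x y.
Proof.
by case/existsP=> i; rewrite cutE_off => /andP[_ E]; apply/existsP; exists i.
Qed.

Lemma connect_off Z c x y : connect (cutrel (off Z c)) x y -> connect (cutrel c) x y.
Proof. by apply: connect_sub => u v /cutrel_off; exact: connect1. Qed.

Lemma cutE_prec c i x y : cutE c i x y -> prec (pi i) x y.
Proof. by case/andP; exact: prec_take_drop. Qed.

(** Cut edges satisfy the shortcut condition for free: the tail of one edge lies left of the cut and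
    the head of another lies right of it. Hence [walk_bridge] applies to walks that avoid [i]. *)
Lemma cut_not_connect c i a b : cutE c i a b -> ~~ connect (cutrel (off [set i] c)) a b.
Proof.
move=> Eab; apply/negP => con.
have [|s ws ls] := @connect_walk n I (cutE (off [set i] c)) _ _ _ _ con.
  by move=> x y /existsP[j Ej]; exists j.
have prE j x y : cutE (off [set i] c) j x y -> prec (pi j) x y.
  by rewrite cutE_off => /andP[_]; exact: cutE_prec.
have short j (x y : 'I_n) (s' : seq (I * 'I_n)) y' : cutE (off [set i] c) j x y ->
    walk (cutE (off [set i] c)) y s' ->
    cutE (off [set i] c) j (wlast y s') y' -> cutE (off [set i] c) j x y'.
  by case/andP=> xA _ _ /andP[_ yB]; rewrite /cutE xA.
have is_ : i \notin unzip1 s.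
  elim: s (a) ws {ls} => [|[j y] s IH] x //=; rewrite cutE_off !inE.
  by case/andP=> /andP[ij _] /IH /negbTE->; rewrite orbF eq_sym.
by have := walk_bridge bf prE short ws is_; rewrite ls (cutE_prec Eab).
Qed.

(** * Cuts lying on cycles *)

Definition cyc c : {set I} :=
  [set i | [exists a, [exists b, cutE c i a b && connect (cutrel c) b a]]].

Lemma cycP c i a b : cutE c i a b -> connect (cutrel c) b a -> i \in cyc c.
Proof.
by move=> E con; rewrite inE; apply/existsP; exists a; apply/existsP; exists b; rewrite E.
Qed.

Definition scc c : rel 'I_n := fun x y => connect (cutrel c) x y && connect (cutrel c) y x.

(** A canonical representative: [pick] returns the same node throughout a strong component. *)
Definition scc_root c x := odflt x [pick y | scc c x y].

Lemma scc_eq c x y : scc c x y -> scc_root c x = scc_root c y.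
Proof.
case/andP=> xy yx; rewrite /scc_root.
have e : scc c x =1 scc c y.
  move=> z; rewrite /scc; apply/andP/andP => -[h1 h2]; split.
  - exact: connect_trans yx h1.
  - exact: connect_trans h2 xy.
  - exact: connect_trans xy h1.
  - exact: connect_trans h2 yx.
rewrite (eq_pick e); case: pickP => //= /(_ y).
by rewrite /scc connect0.
Qed.

Lemma scc_rootP c x : scc c x (scc_root c x).
Proof.
by rewrite /scc_root; case: pickP => //= /(_ x); rewrite /scc connect0.
Qed.

Lemma connect_in_scc c (e : rel 'I_n) x z :
  (forall a b, e a b = (scc_root c a == scc_root c b) && cutrel c a b) ->
  scc c x z -> connect e x z.
Proof.
move=> eE /andP[/connectP[p]]; elim: p x => [|y p IH] x /=.
  by move=> _ ->; rewrite connect0.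
case/andP=> exy py lz zx.
have yz : connect (cutrel c) y z by apply/connectP; exists p.
have zy : connect (cutrel c) z y by apply: connect_trans zx (connect1 exy).
apply: connect_trans (IH y py lz zy); apply: connect1; rewrite eE exy andbT.
apply/eqP/scc_eq; apply/andP; split; first exact: connect1.
exact: connect_trans yz zx.
Qed.

(** Every strong component has a tree leading out of its root and a tree leading into it, with at
    most [#|U|] colours for either kind. If a cut edge from [a] to [b] lies on a cycle and its
    colour is in no tree, then [a] reaches [b] through the root without that colour, against
    [cut_not_connect]. *)
Lemma card_cyc c : #|cyc c| <= 2 * #|U|.
Proof.
pose rt := scc_root c.
have rtK x : rt (rt x) = rt x by symmetry; apply/scc_eq/scc_rootP.
have scc_sym x y : scc c x y = scc c y x by rewrite /scc andbC.
have [||T1 cT1 conT1] := @connect_tree _ I (cutE c) U rt _ rtK.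
- by move=> i x y /andP[_ /mem_drop /piU].
- move=> x; apply: (@connect_in_scc c); first by move=> a b.
  by rewrite scc_sym scc_rootP.
have [||T2 cT2 conT2] := @connect_tree _ I (fun i x y => cutE c i y x) U rt _ rtK.
- by move=> i x y /andP[/mem_take /piU].
- move=> x.
  have := connect_rev [rel b a | (rt a == rt b) && [exists i, cutE c i b a]] (rt x) x.
  move=> H; rewrite [X in is_true X]H /=.
  apply: (@connect_in_scc c); last by rewrite scc_rootP.
  by move=> a b /=; rewrite eq_sym.
rewrite mul2n -addnn; apply: leq_trans (leq_add cT1 cT2).
apply: leq_trans (leq_card_setU _ _); apply: subset_leq_card; apply/subsetP=> i.
rewrite [i \in cyc c]inE => /existsP[a /existsP[b /andP[Eab con]]]; rewrite inE.
apply: contraT; rewrite negb_or => /andP[i1 i2].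
suff con' : connect (cutrel (off [set i] c)) a b by have := cut_not_connect Eab; rewrite con'.
have rab : rt a = rt b.
  apply: scc_eq; rewrite /scc con andbT; apply: connect1.
  by apply/existsP; exists i.
apply: (@connect_trans _ _ (rt a)).
  have := conT2 a.
  have H := connect_rev [rel b a | [exists i in T2, cutE c i b a]] (rt a) a.
  rewrite [X in is_true X -> _]H /=; apply: connect_sub => x y /existsP[j /andP[jT Ej]].
  apply: connect1; apply/existsP; exists j; rewrite cutE_off Ej andbT inE.
  by apply: contraNneq i2 => <-.
rewrite rab; have := conT1 b; apply: connect_sub => x y /existsP[j /andP[jT Ej]].
apply: connect1; apply/existsP; exists j; rewrite cutE_off Ej andbT inE.
by apply: contraNneq i1 => <-.
Qed.

(** * Heights in acyclic cut relations *)

Definition acyclic c := forall x y, cutrel c x y -> ~~ connect (cutrel c) y x.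

Lemma acyclic_off_cyc c : acyclic (off (cyc c) c).
Proof.
move=> x y /existsP[i]; rewrite cutE_off => /andP[ic E].
by apply: contra ic => /connect_off; exact: cycP.
Qed.

Lemma acyclic_off Z c : acyclic c -> acyclic (off Z c).
Proof. by move=> ac x y /cutrel_off/ac; apply: contra; exact: connect_off. Qed.

Lemma acyclic_uniq c x p : acyclic c -> path (cutrel c) x p -> uniq (x :: p).
Proof.
move=> ac; elim: p x => [|y p IH] x //= /andP[exy py].
rewrite -/(uniq (y :: p)) IH // andbT.
apply: contra (ac _ _ exy) => xp; exact: (path_connect py).
Qed.

Fixpoint chain c k v : bool :=
  if k is k'.+1 then [exists a, chain c k' a && cutrel c a v] else true.

Definition height c v : nat := \max_(k < n.+1 | chain c k v) k.

Lemma chain_path c k v : chain c k v ->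
  exists x p, [/\ path (cutrel c) x p, last x p = v & size p = k].
Proof.
elim: k v => [|k IH] v /=; first by exists v, [::].
case/existsP=> a /andP[/IH[x [p [px lx sp]]] av].
by exists x, (rcons p v); rewrite rcons_path last_rcons size_rcons px lx av sp.
Qed.

Lemma chain_lt c k v : acyclic c -> chain c k v -> k < n.
Proof.
move=> ac /chain_path[x [p [px _ <-]]].
have /card_uniqP cu := acyclic_uniq ac px.
by rewrite -[(size p).+1]/(size (x :: p)) -cu; have := max_card (mem (x :: p)); rewrite card_ord.
Qed.

Lemma chain_height c v : chain c (height c v) v.
Proof.
have [|k Pk ek] := @eq_bigmax_cond 'I_n.+1 (fun k => chain c k v) val.
  by apply/card_gt0P; exists ord0.
by rewrite /height ek.
Qed.

Lemma leq_height c k v : acyclic c -> chain c k v -> k <= height c v.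
Proof.
move=> ac ch; have kn : k < n.+1 by rewrite ltnW // ltnS (chain_lt ac ch).
exact: (@leq_bigmax_cond _ (fun k : 'I_n.+1 => chain c k v) val (Ordinal kn)).
Qed.

Lemma height_lt c a v : acyclic c -> cutrel c a v -> height c a < height c v.
Proof.
move=> ac av; apply: leq_height => //=; apply/existsP; exists a.
by rewrite chain_height.
Qed.

Lemma chain_off Z c k v : chain (off Z c) k v -> chain c k v.
Proof.
elim: k v => [|k IH] v //= /existsP[a /andP[/IH ca /cutrel_off av]].
by apply/existsP; exists a; rewrite ca.
Qed.

(* The heights are determined by one colour per node of [U]: the colour of the last
   step of a longest chain ending there. *)
Lemma height_core c : acyclic c -> exists2 K : {set I}, #|K| <= #|U| &
  forall Z, [disjoint Z & K] -> height (off Z c) =1 height c.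
Proof.
move=> ac; pose P v i := [exists a, cutE c i a v && (height c v == (height c a).+1)].
pose f v := [pick i | P v i].
exists [set i | [exists v in U, f v == Some i]].
  rewrite -(card_imset _ (fun i j : I => @Some_inj _ i j)).
  apply: leq_trans (leq_imset_card f U); apply: subset_leq_card.
  apply/subsetP=> _ /imsetP[i + ->]; rewrite inE => /existsP[v /andP[vU /eqP <-]].
  exact: imset_f.
move=> Z /pred0P dis v; apply/eqP; rewrite eqn_leq; apply/andP; split.
  by apply: leq_height => //; apply: chain_off (chain_height _ _).
apply: leq_height; first exact: acyclic_off.
have [k] := ubnP (height c v); elim: k v => // k IH v; rewrite ltnS => hk.
case hv : (height c v) => [|h] //=.
have := chain_height c v; rewrite hv /= => /existsP[a /andP[ca av]].
have ha : height c a = h.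
  apply/eqP; rewrite eqn_leq leq_height // andbT -ltnS -hv; exact: height_lt.
have /existsP[i Ei] := av.
(* The last step of a longest chain to [v] can be chosen in the colour [f v], which belongs to the
   core and so is not switched off by [Z]. *)
have : exists j, f v = Some j.
  rewrite /f; case: pickP => [j _|/(_ i)/negbT/negP[]]; first by exists j.
  by apply/existsP; exists a; rewrite Ei hv ha eqxx.
case=> j fj; have : P v j by move: fj; rewrite /f; case: pickP => // j' Pj [<-].
case/existsP=> b /andP[Eb]; rewrite hv eqSS => /eqP hb.
apply/existsP; exists b; rewrite {1}hb IH ?andTb; last by rewrite -hb -hv.
apply/existsP; exists j; rewrite cutE_off Eb andbT; apply/negP => jZ.
have := dis j; rewrite /= jZ /= inE => /negbT/negP[]; apply/existsP; exists v.
by rewrite fj eqxx andbT; case/andP: Eb => _ /mem_drop /piU.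
Qed.

Definition rank c : 'I_n -> nat := height (off (cyc c) c).

(** An edge of [j] on the return path of some cycle would itself lie on a cycle, so every cycle
    survives without [j]. *)
Lemma cyc_off1 c j : j \notin cyc c -> cyc (off [set j] c) = cyc c.
Proof.
move=> jc; apply/setP=> i; apply/idP/idP.
  rewrite inE => /existsP[a /existsP[b /andP[]]]; rewrite cutE_off => /andP[_ E].
  by move/connect_off; exact: cycP.
move=> ic; have ij : i != j by apply: contraNneq jc => <-.
move: ic; rewrite inE => /existsP[a /existsP[b /andP[E ba]]].
apply: (@cycP _ _ a b); first by rewrite cutE_off E inE ij.
have ab : connect (cutrel c) a b by apply: connect1; apply/existsP; exists i.
case/connectP: ba => p; elim: p b ab {E} => [|y p IH] b ab /=.
  by move=> _ ->; exact: connect0.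
case/andP=> by_ py la; apply: (@connect_trans _ _ y); last first.
  by apply: IH py la; apply: connect_trans ab (connect1 by_).
apply: connect1; have /existsP[k Ek] := by_; apply/existsP; exists k.
rewrite cutE_off Ek inE andbT; apply: contraNneq jc => <-.
apply: cycP Ek _; apply: connect_trans ab; apply/connectP; exists p => //.
Qed.

Definition viol (r : 'I_n -> nat) i t : bool :=
  has (fun y => has (fun z => r z <= r y) (drop t (pi i))) (take t (pi i)).

(** The exceptional paths are those on cycles, at most [2 * #|U|], and the core of the heights, at
    most [#|U|]. The cut of any other path is part of the relation that defines [rank], so the rank
    increases across it. *)
Lemma rank_stable c : exists2 X : {set I}, #|X| <= 3 * #|U| &
  forall j, j \notin X -> rank (off [set j] c) =1 rank c /\ ~~ viol (rank c) j (c j).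
Proof.
have [K cK hK] := height_core (@acyclic_off_cyc c).
exists (cyc c :|: K).
  apply: leq_trans (leq_card_setU _ _) _; rewrite (mulnDl 2 1) mul1n.
  exact: leq_add (card_cyc c) cK.
move=> j; rewrite inE negb_or => /andP[jc jK]; split.
  move=> v; rewrite /rank cyc_off1 // -(hK [set j]) ?disjoints1 //.
  by rewrite !off_off setUC.
apply/hasPn=> y yA; apply/hasPn=> z zB; rewrite -ltnNge.
apply: height_lt; first exact: acyclic_off_cyc.
by apply/existsP; exists j; rewrite cutE_off jc /cutE yA.
Qed.

Lemma eq_viol r r' i t : r =1 r' -> viol r i t = viol r' i t.
Proof.
by move=> e; apply: eq_has => y; apply: eq_has => z; rewrite !e.
Qed.

Lemma few_violations : exists (r : 'I_n -> nat) (X : {set I}), #|X| <= 3 * #|U| /\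
  \sum_(j | j \notin X) \sum_(t < L.+1) viol r j t <= 3 * #|U| * L.+1.
Proof.
(* With [j] switched off the rank does not depend on [c j], so by [resample] a uniform position [t]
   behaves on average like [c j] itself. *)
pose f c j (t : 'I_L.+1) : nat := viol (rank (off [set j] c)) j t.
have [c Hc] : exists c, \sum_j \sum_(t < L.+1) f c j t <= 3 * #|U| * L.+1.
  apply: (exists_le_average [ffun=> ord0]).
  rewrite exchange_big /=.
  have -> : \sum_j \sum_c \sum_(t < L.+1) f c j t = L.+1 * \sum_j \sum_c f c j (c j).
    rewrite big_distrr /=; apply: eq_bigr => j _.
    rewrite (@resample _ _ j (fun c t => f c j t)) ?card_ord //.
    move=> c t u; rewrite /f (_ : off [set j] (upd c j t) = off [set j] c) //.
    by apply/ffunP=> i; rewrite !ffunE inE; case: eqP.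
  rewrite exchange_big /= mulnA [X in _ <= X]mulnC leq_mul2l /=.
  rewrite -sum_nat_const; apply: leq_sum => c _.
  have [X cX HX] := rank_stable c.
  apply: leq_trans cX; rewrite -sum1_card big_mkcond [X in _ <= X]big_mkcond /=.
  apply: leq_sum => j _; rewrite /f; case: ifPn => jX; first exact: leq_b1.
  have [e nv] := HX j jX.
  by rewrite (eq_viol _ _ e) (negbTE nv).
have [X cX HX] := rank_stable c.
exists (rank c), X; split => //; apply: leq_trans Hc.
rewrite [X in _ <= X](bigID (fun j => j \notin X)) /=; apply: leq_trans (leq_addr _ _).
apply: leq_sum => j jX; apply: leq_sum => t _; rewrite /f.
by have [e _] := HX j jX; rewrite (eq_viol _ _ e).
Qed.

Definition kept (r : 'I_n -> nat) i := [seq x <- pi i | ~~ viol r i (index x (pi i))].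

(** The position of [y] in [pi i] is no violation, and cutting there separates [x] from [y]. *)
Lemma kept_prec r i x y : prec (kept r i) x y -> r x < r y.
Proof.
move=> pr; have /and3P[xp yp lt] := subseq_prec (upi i) (filter_subseq _ _) pr.
move: pr => /and3P[_ + _]; rewrite mem_filter => /andP[/hasPn/(_ x) + _].
rewrite in_take // => /(_ lt)/hasPn/(_ y); rewrite -ltnNge; apply.
by rewrite drop_index // inE eqxx.
Qed.

Lemma size_kept r i : size (pi i) <= L.+1 ->
  size (pi i) <= size (kept r i) + \sum_(t < L.+1) viol r i t.
Proof.
move=> sL; rewrite size_filter -{1}(count_predC (fun x => ~~ viol r i (index x (pi i)))) leq_add2l.
rewrite -sum1_count big_mkcond /=; under eq_bigr do rewrite negbK.
have -> : \sum_(x <- pi i) (if viol r i (index x (pi i)) then 1 else 0) =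
    \sum_(0 <= p < size (pi i)) viol r i p.
  case e : {1 3}(pi i) => [|x0 s']; first by rewrite big_nil big_geq.
  rewrite -e (big_nth x0); apply: eq_big_nat => p /andP[_ ps].
  by rewrite index_uniq //; case: viol.
rewrite -(big_mkord xpredT (fun t => viol r i t : nat)) (big_cat_nat _ sL) //=.
exact: leq_addr.
Qed.

(** The exceptional paths are dropped entirely, at most [L.+1] incidences for each of [3 * #|U|]
    paths; on the others the violating positions cost another [3 * #|U| * L.+1]. *)
Lemma ordered_subsystem : (forall i, size (pi i) <= L.+1) ->
  exists (r : 'I_n -> nat) (kap : I -> seq 'I_n),
  [/\ forall i, subseq (kap i) (pi i), forall i x y, prec (kap i) x y -> r x < r y &
      \sum_i size (pi i) <= \sum_i size (kap i) + 6 * L.+1 * #|U| ].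
Proof.
move=> szL; have [r [X [cX sX]]] := few_violations.
exists r, (fun i => if i \in X then [::] else kept r i); split.
- by move=> i; case: ifP => _; rewrite ?sub0seq ?filter_subseq.
- by move=> i x y; case: ifP => _ //; exact: kept_prec.
rewrite (bigID (mem X)) [X in _ <= X + _](bigID (mem X)) /=.
rewrite [X in _ <= X + _ + _]big1 ?add0n; last by move=> i ->.
have H1 : \sum_(i in X) size (pi i) <= 3 * #|U| * L.+1.
  apply: (@leq_trans (\sum_(i in X) L.+1)); first exact: leq_sum.
  by rewrite sum_nat_const leq_mul2r cX orbT.
have H2 : \sum_(i | i \notin X) size (pi i) <=
    \sum_(i | i \notin X) size (if i \in X then [::] else kept r i) + 3 * #|U| * L.+1.
  apply: leq_trans (leq_add (leqnn _) sX); rewrite -big_split /=.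
  by apply: leq_sum => i iX; rewrite (negbTE iX); exact: size_kept.
by apply: leq_trans (leq_add H1 H2) _; rewrite addnCA leq_add2l -!mulnDl mulnAC.
Qed.

End Cuts.

(** * Random labels along the paths *)

Lemma expn_bernoulli m k : m ^ k.+1 + k.+1 * m ^ k <= m.+1 ^ k.+1.
Proof.
elim: k => [|k IH]; first by rewrite !expn1 expn0 addn1.
rewrite [X in _ <= X]expnS mulSn.
have h : m ^ k.+1 <= m.+1 ^ k.+1 by rewrite leq_exp2r.
move: IH h; rewrite !expnS; move: (m ^ k) (m.+1 ^ k) => a b; nia.
Qed.

(** Bernoulli's inequality gives [(1 - 1/T)^T <= 1/2]; the sixth power gives [1/64]. *)
Lemma expn_64 T a : 0 < T -> 6 * T <= a -> 64 * T.-1 ^ a <= T ^ a.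
Proof.
case: T => // m _ ha /=; rewrite -(subnKC ha) !expnD !(mulnC 6) !expnM.
have h : 2 * m ^ m.+1 <= m.+1 ^ m.+1.
  by apply: leq_trans (expn_bernoulli m m);
    rewrite mul2n -addnn leq_add2l expnS leq_mul2r leqnSn orbT.
have h6 : 64 * (m ^ m.+1) ^ 6 <= (m.+1 ^ m.+1) ^ 6.
  by rewrite -[64]/(2 ^ 6) -expnMn leq_exp2r.
by rewrite mulnA; apply: leq_mul => //; case: (a - _) => // k; rewrite leq_exp2r.
Qed.

Section RandomLabels.
Import Order.TTheory GRing.Theory Num.Theory.
Local Open Scope ring_scope.

Lemma exists_le_sum (R : realFieldType) (C : finType) (c0 : C) (f : C -> R) b :
  \sum_(c : C) f c <= #|C|%:R * b -> exists c, f c <= b.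
Proof.
move=> H; apply/existsP; apply: contraLR H; rewrite negb_exists -ltNge => /forallP H.
have -> : #|C|%:R * b = \sum_(c : C) b by rewrite sumr_const mulr_natl.
apply: ltr_sum; first by apply/hasP; exists c0; rewrite ?mem_index_enum.
by move=> c _; rewrite ltNge.
Qed.

Section Labels.
Variables (R : realFieldType) (V I : finType) (T' : nat) (Lb : V -> {set I}).
Let T := T'.+1.

Implicit Types (F : {set V * I}) (h : {ffun I -> 'I_T}).

Definition avail F v : {set I} := [set a in Lb v | (v, a) \notin F].

(** Half of [12 * T] incidences is the [6 * T] that [expn_64] requires. *)
Definition good F v := (12 * T <= #|Lb v|)%N && (#|Lb v| <= 2 * #|avail F v|)%N.

Definition hit h F v (k : nat) := [exists a in avail F v, val (h a) == k].

Definition bump_level h F v k := if hit h F v k then k.+1 else k.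

(** A greedy pass along [l]: the level rises by one at each node that offers the current level at an
    incidence outside [F]. *)
Fixpoint run (g : V -> {ffun I -> 'I_T}) F (l : seq V) (k : nat) : nat :=
  if l is v :: l' then run g F l' (bump_level (g v) F v k) else k.

(* Exponential potential for the union bound over [F]: a walk stuck below level [T] has
   weight at least [64 ^- T], while each good node divides the mean weight by [32]. *)
Definition psi (k : nat) : R := if (k < T)%N then 64%:R ^- k else 0.

Lemma psi_ge0 k : 0 <= psi k.
Proof. by rewrite /psi; case: ifP => // _; rewrite invr_ge0 exprn_ge0. Qed.

Lemma card_miss (A : {set I}) k : (6 * T <= #|A|)%N -> (k < T)%N ->
  (64 * #|[set h : {ffun I -> 'I_T} | [forall a in A, val (h a) != k]]|
     <= #|{ffun I -> 'I_T}|)%N.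
Proof.
move=> hA kT; pose P a : pred 'I_T := if a \in A then predC1 (Ordinal kT) else predT.
have -> : #|[set h : {ffun I -> 'I_T} | [forall a in A, val (h a) != k]]| = #|family P|.
  apply: eq_card => h; rewrite inE; apply/forall_inP/familyP => H a.
    by rewrite /P; case: ifP => // aA; rewrite inE -val_eqE /= H.
  by move=> aA; have := H a; rewrite /P aA inE -val_eqE.
rewrite card_family card_ffun card_ord.
have -> : foldr muln 1%N [seq #|P a| | a : I] = (\prod_(a : I) #|P a|)%N.
  by rewrite foldrE big_image.
rewrite (bigID (mem A)) /=.
have -> : (\prod_(a in A) #|P a| = T.-1 ^ #|A|)%N.
  rewrite -prod_nat_const; apply: eq_bigr => a aA; rewrite /P aA.
  by have := cardC1 (Ordinal kT); rewrite card_ord.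
have -> : (\prod_(a | a \notin A) #|P a| = T ^ #|~: A|)%N.
  rewrite -prod_nat_const; apply: eq_big => a; first by rewrite inE.
  by move=> aA; rewrite /P (negbTE aA) card_ord.
by rewrite -(cardsC A) expnD mulnA leq_mul2r expn_64 // orbT.
Qed.

(** At a good node a miss has probability at most [1/64], and a hit divides [psi] by at least 64;
    together they give [1/32]. At any other node [psi] does not increase. *)
Lemma sum_psi F v k : \sum_(h : {ffun I -> 'I_T}) psi (bump_level h F v k) <=
  #|{ffun I -> 'I_T}|%:R * (psi k * (if good F v then 32%:R^-1 else 1)).
Proof.
have ple h : psi (bump_level h F v k) <= psi k.
  rewrite /bump_level; case: ifP => // _; rewrite /psi.
  case: ltnP => [kT|kT]; last by case: ifP => // _; rewrite invr_ge0 exprn_ge0.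
  rewrite (ltnW kT) lef_pV2 ?posrE ?exprn_gt0 ?ltr0n //.
  by rewrite exprS ler_peMl ?exprn_ge0 ?ler1n ?ler0n.
have [/andP[d12 gd]|_] := boolP (good F v); last first.
  by rewrite mulr1 mulr_natl -sumr_const; apply: ler_sum => h _.
have [kT|kT] := ltnP k T; last first.
  have -> : psi k = 0 by rewrite /psi ltnNge kT.
  rewrite mul0r mulr0; apply: sumr_le0 => h _; apply: le_trans (ple h) _.
  by rewrite /psi ltnNge kT.
have hA : (6 * T <= #|avail F v|)%N by move: d12 gd; lia.
have cm := card_miss hA kT; set M := [set h | _] in cm.
apply: (@le_trans _ _ (\sum_(h : {ffun I -> 'I_T}) (64%:R ^- k.+1 + (h \in M)%:R * 64%:R ^- k))).
  apply: ler_sum => h _; rewrite /bump_level; case: ifPn => hh.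
    apply: (@le_trans _ _ (64%:R ^- k.+1)).
      by rewrite /psi; case: ifP => // _; rewrite invr_ge0 exprn_ge0.
    by rewrite lerDl mulr_ge0 ?ler0n // invr_ge0 exprn_ge0.
  have -> : h \in M.
    rewrite inE; apply/forall_inP => a aA; apply: contra hh => ha.
    by apply/existsP; exists a; rewrite aA.
  by rewrite mul1r /psi kT lerDr invr_ge0 exprn_ge0.
rewrite big_split /= sumr_const -mulr_suml -natr_sum.
rewrite -[X in X + _]mulr_natl /psi kT.
have -> : (\sum_(h : {ffun I -> 'I_T}) (h \in M) = #|M|)%N.
  by rewrite -sum1_card [RHS]big_mkcond /=; apply: eq_bigr => h _; case: (h \in M).
have cm' : 64%:R * #|M|%:R <= #|{ffun I -> 'I_T}|%:R :> R by rewrite -natrM ler_nat.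
rewrite exprS invfM mulrCA; set e : R := 64%:R ^- k.
have e0 : 0 <= e by rewrite invr_ge0 exprn_ge0.
move: (#|{ffun _ -> _}|%:R : R) (#|M|%:R : R) cm' e0 => N m; clear; nra.
Qed.

Lemma eq_run g g' F l k : {in l, g =1 g'} -> run g F l k = run g' F l k.
Proof.
elim: l k => [|v l IH] k //= e; rewrite e ?inE ?eqxx // IH // => x xl.
by rewrite e // inE xl orbT.
Qed.

(** Conditional expectations: the labels at each node are fixed by one averaging over all [F] at
    once, with the later nodes counted at their expected factor. Since [l] has no repetition, no
    label is chosen twice. *)
Lemma path_labels l (w : {set V * I} -> R) (k : {set V * I} -> nat) :
  uniq l -> (forall F, 0 <= w F) -> exists g,
  \sum_F w F * psi (run g F l (k F)) <= \sum_F w F * (psi (k F) * 32%:R ^- count (good F) l).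
Proof.
elim: l k => [|v l IH] k.
  by move=> _ w0; exists (fun=> [ffun=> ord0]); apply: ler_sum => F _ /=; rewrite expr0 invr1 mulr1.
move=> /= /andP[vl ul] w0.
have [h Hh] : exists h, \sum_F w F * 32%:R ^- count (good F) l * psi (bump_level h F v (k F)) <=
    \sum_F w F * 32%:R ^- count (good F) l * (psi (k F) * (if good F v then 32%:R^-1 else 1)).
  apply: (exists_le_sum [ffun=> ord0]); rewrite exchange_big mulr_sumr /=; apply: ler_sum => F _.
  rewrite -mulr_sumr mulrCA ler_wpM2l ?sum_psi //.
  by rewrite mulr_ge0 ?w0 // invr_ge0 exprn_ge0.
have [g Hg] := IH (fun F => bump_level h F v (k F)) ul w0.
exists (fun x => if x == v then h else g x).
have e F : run (fun x => if x == v then h else g x) F l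
      (bump_level (if v == v then h else g v) F v (k F)) =
    run g F l (bump_level h F v (k F)).
  rewrite eqxx; apply: eq_run => x xl; case: eqP => // xv.
  by rewrite -xv xl in vl.
under eq_bigr do rewrite e.
apply: le_trans Hg _; apply: le_trans (le_trans _ Hh) _.
  by apply: ler_sum => F _; rewrite -mulrA [X in _ * X <= _]mulrC.
apply: ler_sum => F _; rewrite -mulrA ler_wpM2l ?w0 //.
case: (good F v); rewrite /= ?add0n ?add1n ?mulr1 1?mulrC // exprS invfM.
by rewrite -mulrA [X in _ * X]mulrC.
Qed.

(** The paths are treated one at a time; the weight [w] absorbs the factors of all the other paths,
    settled or still expected. *)
Lemma family_labels (pi : I -> seq V) (s : seq I) (w : {set V * I} -> R) :
  uniq s -> (forall i, uniq (pi i)) -> (forall F, 0 <= w F) ->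
  exists g : I -> V -> {ffun I -> 'I_T},
  \sum_F w F * \prod_(i <- s) psi (run (g i) F (pi i) 0) <=
  \sum_F w F * \prod_(i <- s) 32%:R ^- count (good F) (pi i).
Proof.
move=> + upi; elim: s w => [|i s IH] w.
  by move=> _ w0; exists (fun _ _ => [ffun=> ord0]); apply: ler_sum => F _; rewrite !big_nil.
move=> /= /andP[is_ us] w0.
pose P F := \prod_(j <- s) (32%:R ^- count (good F) (pi j) : R).
have P0 F : 0 <= P F by apply: prodr_ge0 => j _; rewrite invr_ge0 exprn_ge0.
have [h Hh] := @path_labels (pi i) (fun F => w F * P F) (fun=> 0%N) (upi i)
  (fun F => mulr_ge0 (w0 F) (P0 F)).
have [g Hg] := IH (fun F => w F * psi (run h F (pi i) 0)) us
  (fun F => mulr_ge0 (w0 F) (psi_ge0 _)).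
exists (fun j => if j == i then h else g j).
have e F : \prod_(j <- i :: s) psi (run (if j == i then h else g j) F (pi j) 0) =
    psi (run h F (pi i) 0) * \prod_(j <- s) psi (run (g j) F (pi j) 0).
  rewrite big_cons eqxx; congr (_ * _); apply: eq_big_seq => j js.
  by case: eqP => // ji; rewrite -ji js in is_.
under eq_bigr do rewrite e mulrA.
apply: le_trans Hg _; apply: le_trans (le_trans _ Hh) _.
  by apply: ler_sum => F _; rewrite -!mulrA [X in _ * X <= _]mulrC.
apply: ler_sum => F _; rewrite big_cons -/(P F) /psi ltn0Sn expr0 invr1 mul1r.
by rewrite -mulrA [X in _ * X <= _]mulrC.
Qed.

Lemma exists_labelling (pi : I -> seq V) (X : {set V * I}) (s : nat) :
  (forall i, uniq (pi i)) -> (forall i v, (v \in pi i) = (i \in Lb v)) ->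
  (forall i v, v \in pi i -> (12 * T <= #|Lb v|)%N) ->
  X = [set p | p.2 \in Lb p.1] -> s = #|X| -> s = (\sum_i size (pi i))%N ->
  (0 < s)%N -> (3 * #|I| * T <= s)%N ->
  exists g : I -> V -> {ffun I -> 'I_T}, forall F, F \subset X -> (16 * #|F| <= s)%N ->
    exists i, (T <= run (g i) F (pi i) 0)%N.
Proof.
move=> upi piLb LbT XE sX sE s0 h3; pose adm F := (F \subset X) && (16 * #|F| <= s)%N.
have [g Hg] := @family_labels pi (enum I) (fun F => (adm F)%:R) (enum_uniq _) upi
  (fun F => ler0n _ _).
exists g => F0 F0X F0s; apply/existsP; apply: contraT; rewrite negb_exists => /forallP lt0.
(* A bad node has lost at least half of its incidences to [F], so bad nodes carry at most
   [2 * #|F| <= s / 8] incidences. Five times the remaining [7 s / 8] exceeds [3 s], which is at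
   least [s + 6 * T * #|I|]. *)
have goodF F : adm F -> (s + 6 * T * #|I| < 5 * \sum_i count (good F) (pi i))%N.
  move=> /andP[FX Fs].
  have bad : (\sum_i count (predC (good F)) (pi i) <= 2 * #|F|)%N.
    have -> : (\sum_i count (predC (good F)) (pi i) = \sum_(v | ~~ good F v) #|Lb v|)%N.
      transitivity (\sum_i \sum_(v | ~~ good F v) (v \in pi i))%N.
        apply: eq_bigr => i _; rewrite -size_filter -(card_uniqP (filter_uniq _ (upi i))).
        rewrite -sum1_card big_mkcond [RHS]big_mkcond /=; apply: eq_bigr => v _.
        by rewrite mem_filter /=; case: (good F v) => //=; case: (v \in pi i).
      rewrite exchange_big /=; apply: eq_bigr => v _; rewrite -sum1_card [RHS]big_mkcond /=.
      by apply: eq_bigr => i _; rewrite piLb; case: (i \in Lb v).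
    have -> : #|F| = (\sum_v #|[set a | (v, a) \in F]|)%N.
      transitivity (\sum_v \sum_a ((v, a) \in F))%N.
        rewrite pair_big /= -sum1_card big_mkcond /=.
        by apply: eq_bigr => -[v a] _ /=; case: ((v, a) \in F).
      apply: eq_bigr => v _; rewrite -sum1_card [RHS]big_mkcond /=.
      by apply: eq_bigr => a _; rewrite inE; case: ((v, a) \in F).
    rewrite big_distrr /= [X in (_ <= X)%N](bigID (fun v => ~~ good F v)) /=.
    apply: leq_trans (leq_addr _ _); apply: leq_sum => v ng.
    have [->|[i iL]] := set_0Vmem (Lb v); first by rewrite cards0.
    have d12 : (12 * T <= #|Lb v|)%N by apply: (LbT i); rewrite piLb.
    have cL : (#|Lb v| <= #|avail F v| + #|[set a | (v, a) \in F]|)%N.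
      apply: leq_trans (leq_card_setU _ _); apply: subset_leq_card; apply/subsetP=> a aL.
      by rewrite !inE aL /=; case: ((v, a) \in F).
    move: ng; rewrite /good d12 /= -ltnNge; move: cL.
    by move: #|Lb v| #|avail F v| #|[set a | (v, a) \in F]|; clear => a b c; lia.
  have tot : (\sum_i count (good F) (pi i) + \sum_i count (predC (good F)) (pi i) = s)%N.
    by rewrite -big_split /= sE; apply: eq_bigr => i _; rewrite count_predC.
  by move: bad tot h3 s0 Fs; clear; nia.
(* If every run fails on [F0], the term of [F0] alone is at least [64 ^- (T * #|I|)]. *)
have low : (2%:R : R) ^- (6 * T * #|I|) <=
    \sum_F (adm F)%:R * \prod_(i <- enum I) psi (run (g i) F (pi i) 0).
  rewrite (bigD1 F0) //= {1}/adm F0X F0s mul1r.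
  apply: (@le_trans _ _ (\prod_(i <- enum I) psi (run (g i) F0 (pi i) 0))); last first.
    rewrite lerDl; apply: sumr_ge0 => F _; rewrite mulr_ge0 ?ler0n // prodr_ge0 // => i _.
    exact: psi_ge0.
  have -> : (2%:R : R) ^- (6 * T * #|I|) = \prod_(i <- enum I) (64%:R ^- T).
    rewrite big_enum /= prodr_const -!exprVn -exprM (_ : 64%:R^-1 = 2%:R^-1 ^+ 6 :> R).
      by rewrite -exprM mulnA.
    by rewrite exprVn -natrX.
  rewrite !big_enum /=; apply: ler_prod => i _; rewrite invr_ge0 exprn_ge0 //=.
  have lt := lt0 i; rewrite -ltnNge in lt; rewrite /psi lt.
  by rewrite lef_pV2 ?posrE ?exprn_gt0 ?ltr0n //; apply: ler_weXn2l; rewrite ?ler1n // ltnW.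
(* Union bound: there are [2 ^ s] subsets of [X], and by [goodF] the term of each is at most
   [2 ^- (s + 6 * T * #|I|).+1]. *)
have up : \sum_F (adm F)%:R * \prod_(i <- enum I) 32%:R ^- count (good F) (pi i) <=
    (2%:R : R) ^- (6 * T * #|I|).+1.
  apply: (@le_trans _ _ (\sum_(F in powerset X) (2%:R : R) ^- (s + 6 * T * #|I|).+1)).
    rewrite [leRHS]big_mkcond /=; apply: ler_sum => F _.
    case aF : (adm F); last by rewrite mul0r; case: ifP => // _; rewrite invr_ge0 exprn_ge0.
    rewrite mul1r powersetE; have /andP[-> _] := aF.
    rewrite big_enum /= prodfV prodrXr -exprVn (_ : 32%:R^-1 = 2%:R^-1 ^+ 5 :> R); last first.
      by rewrite exprVn -natrX.
    rewrite -exprM exprVn lef_pV2 ?posrE ?exprn_gt0 ?ltr0n // ler_weXn2l ?ler1n //.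
    exact: goodF.
  rewrite sumr_const card_powerset -sX -[X in X <= _]mulr_natl natrX -addnS exprD invfM mulrA.
  by rewrite divff ?mul1r // expf_neq0 // pnatr_eq0.
have := le_trans low (le_trans Hg up).
rewrite lef_pV2 ?posrE ?exprn_gt0 ?ltr0n // leNgt ltr_eXn2l ?ltr1n //.
by rewrite ltnSn.
Qed.

End Labels.

End RandomLabels.

(** * Incidences as nodes of a network *)

Section OrderedSystem.
Variables (n : nat) (I : finType) (kap : I -> seq 'I_n) (rho : 'I_n -> nat).
Hypothesis ukap : forall i, uniq (kap i).
Hypothesis bf : bridge_free kap.
Hypothesis incr : forall i x y, prec (kap i) x y -> rho x < rho y.

Let E (i : I) : rel 'I_n := prec (kap i).

Lemma rho_prec i x y : x \in kap i -> y \in kap i -> rho x < rho y -> prec (kap i) x y.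
Proof.
move=> xk yk lt; rewrite /prec xk yk /=.
have [//|yx|/index_inj e] := ltngtP (index x (kap i)) (index y (kap i)).
  have : prec (kap i) y x by rewrite /prec xk yk.
  by move/incr/(ltn_trans lt); rewrite ltnn.
by move: lt; rewrite e // ltnn.
Qed.

Lemma walk_rho (x : 'I_n) (s : seq (I * 'I_n)) :
  walk E x s -> rho x + (0 < size s) <= rho (wlast x s).
Proof.
elim: s x => [|[i y] s IH] x /=; first by rewrite addn0.
case/andP=> /incr lt /IH le; rewrite -[wlast _ _]/(wlast y s) addn1.
by apply: leq_trans lt _; apply: leq_trans le; exact: leq_addr.
Qed.

(** By [walk_bridge] the walk uses [i] somewhere, since [rho] increases along walks and thus allows
    shortcuts. The parts before and after that edge again join nodes of path [i] in increasing
    order, so induction applies to them. *)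
Lemma walk_forced i (x : 'I_n) (s : seq (I * 'I_n)) :
  walk E x s -> prec (kap i) x (wlast x s) -> all (pred1 i) (unzip1 s).
Proof.
have [m] := ubnP (size s); elim: m s x => // m IH s x; rewrite ltnS => sm w pr.
have [/mapP[[j y] jy /= ij]|is_] := boolP (i \in unzip1 s); last first.
  have short j (u v : 'I_n) (t : seq (I * 'I_n)) v' : E j u v -> walk E v t ->
      E j (wlast v t) v' -> E j u v'.
    move=> uv wt tv; apply: rho_prec; first by case/and3P: uv.
      by case/and3P: tv.
    apply: leq_trans (incr uv) _; apply: leq_trans (leq_trans (leq_addr _ _) (walk_rho wt)) _.
    exact: ltnW (incr tv).
  by have := walk_bridge bf (fun _ _ _ => id) short w is_; rewrite pr.
move: jy; rewrite -{j}ij => jy; case/splitPr: jy sm w pr => s1 s2 sm.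
rewrite walk_cat wlast_cat /= => /and3P[w1 E1 w2].
rewrite -[wlast (wlast _ _) _]/(wlast y s2) => pr.
have /and3P[xk lk _] := pr; have /and3P[x1k yk _] := E1.
rewrite size_cat /= in sm.
have -> : unzip1 (s1 ++ (i, y) :: s2) = unzip1 s1 ++ i :: unzip1 s2 by rewrite /unzip1 map_cat.
rewrite all_cat /= eqxx /=; apply/andP; split.
  case: s1 sm w1 E1 x1k => [|p s1] // sm w1 E1 x1k; apply: (IH _ x) => //.
    by apply: leq_trans sm; rewrite addnS ltnS leq_addr.
  by apply: rho_prec => //; have := walk_rho w1; rewrite addn1.
case: s2 sm w2 pr lk => [|p s2] // sm w2 pr lk; apply: (IH _ y) => //.
  by apply: leq_trans sm; rewrite addnS ltnS leq_addl.
by apply: rho_prec => //; have := walk_rho w2; rewrite addn1.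
Qed.

Variable T' : nat.
Let T := T'.+1.
Hypothesis T_gt1 : 0 < T'.
Let Lb (v : 'I_n) : {set I} := [set i | v \in kap i].
Let s := \sum_i size (kap i).

Definition incidence := {p : 'I_n * I | p.1 \in kap p.2}.

Lemma card_incidences : #|[set p : 'I_n * I | p.1 \in kap p.2]| = s.
Proof.
rewrite -sum1_card big_mkcond /=.
rewrite (eq_bigr (fun p => (p.1 \in kap p.2) : nat)); last first.
  by move=> [v i] _; rewrite inE /=; case: (v \in kap i).
rewrite -(pair_big predT predT (fun v i => (v \in kap i) : nat)) /= exchange_big /=.
apply: eq_bigr => i _; rewrite -(card_uniqP (ukap i)) -sum1_card [RHS]big_mkcond /=.
by apply: eq_bigr => v _; case: (v \in kap i).
Qed.

Lemma card_incidence : #|{: incidence}| = s.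
Proof. by rewrite card_sig -card_incidences; apply: eq_card => p; rewrite !inE. Qed.

Variable g : I -> 'I_n -> {ffun I -> 'I_T}.

(** An incidence [(v, a)] has a separate level for every path [i], not only for [a]. A chain for [i]
    follows the nodes of [i] but may occupy their incidences with other paths. *)
Definition level i (x : incidence) : nat := g i (val x).1 (val x).2.

Definition step : rel incidence := fun x y =>
  [exists i, prec (kap i) (val x).1 (val y).1 && (level i y == (level i x).+1)].

Definition demand : rel incidence := fun x y =>
  [exists i, [&& prec (kap i) (val x).1 (val y).1, level i x == 0 & level i y == T']].

(** The first components form a coloured walk between two nodes of path [i]. By [walk_forced] all
    its colours are [i], so each step raises the level for [i] by exactly one, from 0 to [T']. *)
Lemma demand_length x p : path step x p -> demand x (last x p) -> T <= (size p).+1.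
Proof.
move=> px /existsP[i /and3P[pr /eqP l0 /eqP lT]].
have [w [ww lw Hw]] : exists w : seq (I * 'I_n), [/\ walk E (val x).1 w,
    wlast (val x).1 w = (val (last x p)).1 &
    all (pred1 i) (unzip1 w) -> level i (last x p) = level i x + size p].
  elim: p x px {pr l0 lT} => [|y p IH] x /=; first by exists [::]; rewrite addn0.
  case/andP=> /existsP[j /andP[xy /eqP ly]] /IH[w [ww lw Hw]].
  exists ((j, (val y).1) :: w); split=> //=; first by rewrite ww /E xy.
  by case/andP=> /eqP ji /Hw ->; rewrite -ji ly addSnnS.
rewrite -lw in pr; have := Hw (walk_forced ww pr).
by rewrite l0 lT add0n => <-.
Qed.

(** Collects the incidences at which the greedy pass rises, up to level [T - 1]. *)
Lemma run_chain (h : 'I_n -> {ffun I -> 'I_T}) (F : {set 'I_n * I}) (l : seq 'I_n) k :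
  T <= run Lb h F l k -> exists z : seq ('I_n * I),
    [/\ subseq (unzip1 z) l, all (fun p => p.2 \in avail Lb F p.1) z &
        [seq nat_of_ord (h p.1 p.2) | p <- z] = iota k (T - k)].
Proof.
elim: l k => [|v l IH] k /=.
  by move=> Tk; exists [::]; rewrite (eqP (_ : T - k == 0)) // subn_eq0.
rewrite /bump_level; case: ifP => [/existsP[a /andP[aF /eqP ha]]|_] /IH[z [sz az lz]]; last first.
  by exists z; split=> //; apply: subseq_trans sz (subseq_cons _ _).
have [kT|kT] := ltnP k T.
  exists ((v, a) :: z); split=> /=; rewrite ?eqxx ?aF //.
  by rewrite lz ha -(subSS k T) subSn.
exists [::]; split; rewrite ?sub0seq //=.
by rewrite (eqP (_ : T - k == 0)) // subn_eq0.
Qed.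

Lemma chain_step i (x : incidence) p k : subseq [seq (val y).1 | y <- x :: p] (kap i) ->
  map (level i) (x :: p) = iota k (size p).+1 -> path step x p.
Proof.
elim: p x k => [|y p IH] x k //= sub [lx ly lp]; apply/andP; split.
  apply/existsP; exists i; rewrite prec_subseq // lx ly eqxx andbT.
  apply: subseq_trans sub; rewrite /= !eqxx; exact: sub0seq.
apply: (IH y k.+1) => /=; last by rewrite ly lp.
by apply: subseq_trans sub; exact: subseq_cons.
Qed.

Hypothesis Hg : forall F : {set 'I_n * I}, F \subset [set p | p.2 \in Lb p.1] ->
  16 * #|F| <= s -> exists i, T <= run Lb (g i) F (kap i) 0.

Lemma demand_survives (F : {set incidence}) : 16 * #|F| <= s ->
  exists x p, [/\ path step x p, demand x (last x p) & all (fun y => y \notin F) (x :: p)].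
Proof.
move=> Fs.
have [||i Ti] := Hg (F := val @: F).
- by apply/subsetP=> _ /imsetP[x _ ->]; rewrite !inE; exact: valP x.
- by rewrite card_imset //; exact: val_inj.
have [z [sz az lz]] := run_chain Ti; rewrite subn0 in lz.
have [xs xz] : exists xs : seq incidence, map val xs = z.
  elim: z az {sz lz} => [|p z IH] /=; first by exists [::].
  case/andP; rewrite !inE => /andP[pk _] /IH[xs <-].
  by exists (exist (fun p : 'I_n * I => is_true (p.1 \in kap p.2)) p pk :: xs).
rewrite -{z}xz in sz az lz; rewrite /unzip1 -map_comp in sz; rewrite -map_comp in lz.
case: xs sz az lz => [|x p] // sz az lz.
have szp : size p = T'.
  by have := congr1 size lz; rewrite size_map size_iota => -[].
exists x, p; split.
- by apply: (@chain_step i x p 0) => //; rewrite szp.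
- apply/existsP; exists i; apply/and3P; split.
  + rewrite prec_subseq //; apply: subseq_trans sz; rewrite /= eqxx sub1seq.
    apply: map_f (fun y : incidence => (val y).1) _ _ _.
    case: p szp {az lz} => [|y p] /=; last by rewrite mem_last.
    (* With at least two levels the chain ends at a node different from its first, as a strict
       precedence requires. *)
    by move=> e; have := T_gt1; rewrite -e.
  + by move: lz => [] l0 _; apply/eqP.
  + have lz' : map (level i) (x :: p) = iota 0 T := lz.
    apply/eqP; have := congr1 (last 0) lz'; rewrite /= last_map => ->.
    by have := T_gt1; case: (T') => // t _; rewrite -nth_last size_iota nth_iota ?add1n.
- apply/allP=> y yx; apply/negP => yF.
  move/allP: az => /(_ (val y)); rewrite map_f // => /(_ isT).
  by rewrite inE => /andP[_ /negP[]]; rewrite -surjective_pairing; exact: imset_f.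
Qed.

End OrderedSystem.

(** * Long paths give a network with a large gap *)

Lemma sum_size_low_degree n (I : finType) (kap : I -> seq 'I_n) (U : {set 'I_n}) D :
  (forall i, uniq (kap i)) -> (forall i, {subset kap i <= U}) ->
  \sum_i size (kap i) <=
    \sum_i size [seq x <- kap i | D <= #|[set j | x \in kap j]|] + D * #|U|.
Proof.
move=> ukap kapU.
pose low x := #|[set j | x \in kap j]| < D.
have -> : \sum_i size (kap i) = \sum_i size [seq x <- kap i | D <= #|[set j | x \in kap j]|]
    + \sum_i count low (kap i).
  rewrite -big_split /=; apply: eq_bigr => i _; rewrite size_filter.
  rewrite -(count_predC (fun x => D <= #|[set j | x \in kap j]|)); congr (_ + _).
  by apply: eq_count => x /=; rewrite -ltnNge.
rewrite leq_add2l mulnC -sum_nat_const.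
have -> : \sum_i count low (kap i) = \sum_i \sum_(x in U | low x) (x \in kap i).
  apply: eq_bigr => i _; rewrite -size_filter -(card_uniqP (filter_uniq _ (ukap i))).
  rewrite -sum1_card big_mkcond [RHS]big_mkcond /=; apply: eq_bigr => x _.
  rewrite mem_filter; case: (low x) => /=; last by rewrite andbF.
  by rewrite andbT; case: ifP => [/kapU ->|_] //; case: ifP.
rewrite exchange_big /= big_mkcondr /=; apply: leq_sum => x _.
case: ifP => // /ltnW; congr (_ <= _); rewrite -sum1_card big_mkcond /=.
by apply: eq_bigr => i _; rewrite inE; case: (_ \in _).
Qed.

Lemma exists_gap_network n K L (I : finType) (pi : I -> seq 'I_n) :
  0 < K -> 24 <= L -> 0 < #|I| -> (forall i, uniq (pi i)) -> bridge_free pi ->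
  (forall i, size (pi i) = K * L) -> 28 * n <= K * #|I| ->
  exists (X : finType) (r dm : rel X),
    [/\ 0 < #|X| <= #|I| * L,
        forall x p, path r x p -> dm x (last x p) -> L %/ 12 <= (size p).+1 &
        forall F : {set X}, 16 * #|F| <= #|X| -> exists x p,
          [/\ path r x p, dm x (last x p) & all (fun y => y \notin F) (x :: p)]].
Proof.
move=> K0 L24 I0 upi bf szpi nK.
have L0 : 0 < L by exact: leq_trans L24.
have [U HU] := sample_nodes K0 L0 upi szpi nK.
pose pi2 i := take L (filter (mem U) (pi i)).
have sub2 i : subseq (pi2 i) (pi i).
  exact: subseq_trans (take_subseq _ _) (filter_subseq _ _).
have upi2 i : uniq (pi2 i) by exact: subseq_uniq (sub2 i) (upi i).
have bf2 : bridge_free pi2 := bridge_free_sub (fun i j : I => id) upi sub2 bf.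
have pi2U i : {subset pi2 i <= U} by move=> x /mem_take; rewrite mem_filter => /andP[].
have sz2 i : size (pi2 i) = minn (count (mem U) (pi i)) L.
  by rewrite size_take_min size_filter minnC.
have le2 i : size (pi2 i) <= L.-1.+1 by rewrite prednK // sz2 geq_minr.
have [rho [kap [subk incrk szk]]] := ordered_subsystem upi2 bf2 pi2U le2.
rewrite prednK // in szk.
have ukap i : uniq (kap i) := subseq_uniq (subk i) (upi2 i).
have kapU i : {subset kap i <= U} by move=> x /(mem_subseq (subk i)) /pi2U.
pose T := L %/ 12.
have T12 : 12 * T <= L by rewrite mulnC leq_trunc_div.
have T2 : 2 <= T by rewrite leq_divRL.
pose kap2 i := [seq x <- kap i | 12 * T <= #|[set j | x \in kap j]|].
have lowU := sum_size_low_degree (12 * T) ukap kapU.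
have subk2 i : subseq (kap2 i) (kap i) by exact: filter_subseq.
have subk2pi i : subseq (kap2 i) (pi i) := subseq_trans (subk2 i) (subseq_trans (subk i) (sub2 i)).
have ukap2 i : uniq (kap2 i) := subseq_uniq (subk2 i) (ukap i).
have bfk : bridge_free kap2 := bridge_free_sub (fun i j : I => id) upi subk2pi bf.
have incr2 i x y : prec (kap2 i) x y -> rho x < rho y.
  by move/(subseq_prec (ukap i) (subk2 i)) => /incrk.
pose s := \sum_i size (kap2 i).
(* Source of the constant 28: ordering loses at most [6 * L * #|U|] incidences and dropping low
   degrees at most [12 * T * #|U| <= L * #|U|]; four times their sum is [28 * L * #|U|]. *)
have s4 : #|I| * L <= 4 * s.
  move: HU lowU szk; under [X in _ <= 4 * X]eq_bigr do rewrite -sz2.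
  rewrite -/s; set A := \sum_i _; set B := \sum_i _; set u := #|U|.
  have : 12 * T * u <= L * u by rewrite leq_mul2r T12 orbT.
  lia.
have s0 : 0 < s by move: (leq_mul I0 L0) s4; lia.
have s3 : 3 * #|I| * T <= s.
  have : 12 * T * #|I| <= L * #|I| by rewrite leq_mul2r T12 orbT.
  move: s4; lia.
have sL : s <= #|I| * L.
  rewrite -sum_nat_const; apply: leq_sum => i _.
  apply: leq_trans (size_subseq (subk2 i)) _; apply: leq_trans (size_subseq (subk i)) _.
  by rewrite sz2 geq_minr.
pose T' := T.-1; have TE : T'.+1 = T by rewrite prednK // ltnW.
pose Lb (v : 'I_n) : {set I} := [set i | v \in kap2 i].
(* The filter depends on the node alone, so a surviving node keeps all its incidences and its
   degree. *)
have LbT i v : v \in kap2 i -> 12 * T'.+1 <= #|Lb v|.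
  rewrite TE => vk; have := vk; rewrite mem_filter => /andP[deg _].
  apply: leq_trans deg _; apply: subset_leq_card; apply/subsetP => j.
  rewrite !inE mem_filter => ->; rewrite andbT.
  by move: vk; rewrite mem_filter => /andP[].
have sX : s = #|[set p : 'I_n * I | p.2 \in Lb p.1]|.
  by rewrite /s -card_incidences //; apply: eq_card => p; rewrite !inE.
have [||g Hg] := exists_labelling rat ukap2 _ LbT (erefl _) sX (erefl _) s0.
- by move=> i v; rewrite inE.
- by rewrite TE.
have T'0 : 0 < T' by rewrite -ltnS TE.
exists (incidence kap2), (step g), (demand g).
rewrite card_incidence // -/s s0 sL; split=> //.
- by move=> x p px dx; have := demand_length bfk incr2 px dx; rewrite TE.
- exact: demand_survives.
Qed.

Lemma sum_dyadic_ge a t : a < 2 ^ t -> a <= \sum_(h < t) 2 ^ h * (2 ^ h <= a).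
Proof.
(* Replacing [a] by its minimum with [2 ^ t - 1] gives a claim valid for every [a], on which
   induction on [t] works. *)
move=> at_; rewrite -{1}(minn_idPl (_ : a <= (2 ^ t).-1)); last first.
  by rewrite -ltnS prednK // expn_gt0.
elim: t {at_} => [|t IH]; first by rewrite big_ord0 minn0.
rewrite big_ord_recr /= expnS; have := expn_gt0 2 t; move: IH; set S := bigop.body _ _ _.
by case: (leqP (2 ^ t) a) => /=; lia.
Qed.

Lemma dyadic_class (J : finType) (a : J -> nat) t : (forall j, a j < 2 ^ t.+1) ->
  exists h, \sum_j a j <= t.+1 * (2 ^ h * #|[set j | 2 ^ h <= a j]|).
Proof.
move=> at_; pose c h := 2 ^ h * #|[set j | 2 ^ h <= a j]|.
have le : \sum_j a j <= \sum_(h < t.+1) c h.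
  apply: (@leq_trans (\sum_j \sum_(h < t.+1) 2 ^ h * (2 ^ h <= a j))).
    by apply: leq_sum => j _; exact: sum_dyadic_ge.
  rewrite exchange_big /=; apply: leq_sum => h _; rewrite -big_distrr /= leq_mul2l.
  apply/orP; right; rewrite -sum1_card [X in _ <= X]big_mkcond /=.
  by apply: leq_sum => j _; rewrite inE; case: (2 ^ h <= a j).
have [h _ hmax] := @arg_maxnP _ (ord0 : 'I_t.+1) predT (fun h => c h) isT.
exists h; apply: leq_trans le _; apply: (@leq_trans (\sum_(k < t.+1) c h)); last first.
  by rewrite sum_nat_const card_ord.
by apply: leq_sum => k _; exact: hmax.
Qed.

Lemma bridge_free_gap n (Pi : seq (seq 'I_n)) (t := trunc_log 2 n) :
  0 < n -> path_system Pi -> size Pi = n -> girth_gt Pi None -> 0 < ps_size Pi ->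
  ps_size Pi <= 696 * n * t.+1 \/
  exists (X : finType) (r dm : rel X) (T : nat),
    [/\ 0 < #|X|, 2 * #|X| <= ps_size Pi, 0 < T & ps_size Pi <= 696 * n * t.+1 * T] /\
    [/\ forall x p, path r x p -> dm x (last x p) -> T <= (size p).+1 &
        forall F : {set X}, 16 * #|F| <= #|X| -> exists x p,
          [/\ path r x p, dm x (last x p) & all (fun y => y \notin F) (x :: p)]].
Proof.
move=> n0 uPi szPi girth size0.
pose pi (i : 'I_(size Pi)) := nth [::] Pi i.
have upi i : uniq (pi i) by move/allP: uPi; apply; exact: mem_nth.
have sizeE : ps_size Pi = \sum_i size (pi i).
  by rewrite /ps_size sumnE big_map (big_nth [::]) big_mkord.
have [i|h Hh] := @dyadic_class _ (fun i => size (pi i)) t.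
  apply: leq_ltn_trans (trunc_log_ltn n (isT : 1 < 2)).
  by rewrite -(card_uniqP (upi i)) -[X in _ <= X](card_ord n) max_card.
rewrite -sizeE in Hh; set q := #|_| in Hh.
have q0 : 0 < q by case: posnP Hh => // ->; rewrite !muln0; move: size0; lia.
have qn : q <= n by rewrite -[X in _ <= X]szPi -[X in _ <= X]card_ord max_card.
(* Chosen so that [28 * n <= K * q <= 29 * n]: large enough for the sampling, with only a constant
   factor lost. *)
pose K := (28 * n) %/ q + 1.
have Kq : 28 * n <= K * q by rewrite /K addn1 ltnW // ltn_ceil.
have qK : K * q <= 29 * n.
  by rewrite /K mulnDl mul1n; have := leq_trunc_div (28 * n) q; lia.
have K28 : 28 <= K by rewrite /K addn1 ltnW // ltnS leq_divRL // leq_mul2l.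
have K0 : 0 < K by exact: leq_trans K28.
pose L := 2 ^ h %/ K.
have LK : 2 ^ h < L.+1 * K by exact: ltn_ceil.
(* If [L] is below 24, then [2 ^ h * q] is at most [24 * K * q <= 24 * 29 * n = 696 * n]. Otherwise
   [L] is long enough for two levels, and [L.+1 <= 24 * (L %/ 12)] gives the same constant. *)
have [L24|L24] := ltnP L 24.
  left; apply: leq_trans Hh _; rewrite (mulnC (696 * n)) leq_mul2l /=.
  apply: (@leq_trans (24 * K * q)); last by move: qK; lia.
  rewrite leq_mul2r; apply/orP; right; apply: leq_trans (ltnW LK) _.
  by rewrite leq_mul2r L24 orbT.
right.
pose I := {i : 'I_(size Pi) | 2 ^ h <= size (pi i)}.
have cI : #|{: I}| = q by rewrite card_sig; apply: eq_card => i; rewrite !inE.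
pose pi1 (i : I) := take (K * L) (pi (val i)).
have sub1 i : subseq (pi1 i) (pi (val i)) by exact: take_subseq.
have upi1 i : uniq (pi1 i) := subseq_uniq (sub1 i) (upi _).
have bf1 : bridge_free pi1 := bridge_free_sub val_inj upi sub1 (girth_bridge_free girth).
have KL : K * L <= 2 ^ h by rewrite mulnC leq_trunc_div.
have sz1 i : size (pi1 i) = K * L.
  by rewrite size_takel //; exact: leq_trans KL (valP i).
have I0 : 0 < #|{: I}| by rewrite cI.
have nK : 28 * n <= K * #|{: I}| by rewrite cI.
have [X [r [dm [/andP[X0 XL] len surv]]]] := exists_gap_network K0 L24 I0 upi1 bf1 sz1 nK.
exists X, r, dm, (L %/ 12).
have T0 : 2 <= L %/ 12 by rewrite leq_divRL.
split; split=> //; first 2 last.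
- apply: leq_trans Hh _; rewrite (mulnC (696 * n)) -mulnA leq_mul2l /=.
  apply: (@leq_trans (24 * (L %/ 12) * K * q)); last first.
    have : K * q * (L %/ 12) <= 29 * n * (L %/ 12) by rewrite leq_mul2r qK orbT.
    lia.
  rewrite leq_mul2r; apply/orP; right; apply: leq_trans (ltnW LK) _.
  rewrite leq_mul2r; apply/orP; right; have := ltn_ceil L (isT : 0 < 12); lia.
(* As [K] is at least 28, the [q * L] incidences are few enough for each to be split into two nodes
   within [ps_size Pi]. *)
- have big_q : q * 2 ^ h <= ps_size Pi.
    rewrite sizeE /q -sum_nat_const big_mkcond; apply: leq_sum => i _; rewrite inE.
    by case: ifP.
  apply: leq_trans big_q; rewrite cI in XL.
  have : q * (K * L) <= q * 2 ^ h by rewrite leq_mul2l KL orbT.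
  have : q * (28 * L) <= q * (K * L) by rewrite leq_mul2l leq_mul2r K28 !orbT.
  move: XL; lia.
- exact: ltnW.
Qed.

(** * Splitting nodes into edges *)

Section Network.
Variables (N T : nat) (X : finType) (r dm : rel X) (fi fo : X -> 'I_N).
Hypothesis fi_inj : injective fi.
Hypothesis fo_inj : injective fo.
Hypothesis fi_fo : forall x y, fi x != fo y.

Definition node_edge (e : 'I_N * 'I_N) : bool := [exists x, e == (fi x, fo x)].

(* Every [x : X] is split into an edge [fi x -> fo x], so that unit edge capacities
   act as node capacities on the digraph [r]. *)
Definition net_edges : {set 'I_N * 'I_N} :=
  [set e | node_edge e || [exists x, [exists y, r x y && (e == (fo x, fi y))]]].

Definition net_demands : {set 'I_N * 'I_N} :=
  [set e | [exists x, [exists y, dm x y && (e == (fi x, fo y))]]].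

Lemma net_demands_neq p : p \in net_demands -> p.1 != p.2.
Proof. by rewrite inE => /existsP[x /existsP[y /andP[_ /eqP->]]]; exact: fi_fo. Qed.

(** A removed edge is charged to its head only, so it hits at most one [x], although an arc of the
    network touches two. *)
Definition hit_nodes (F : {set 'I_N * 'I_N}) : {set X} :=
  [set x | [exists u, ((u, fi x) \in F) || ((u, fo x) \in F)]].

Lemma card_hit_nodes F : #|hit_nodes F| <= #|F|.
Proof.
pose h (e : 'I_N * 'I_N) := [pick x | (fi x == e.2) || (fo x == e.2)].
have hE x u w : (w == fi x) || (w == fo x) -> h (u, w) = Some x.
  move=> w_x; rewrite /h; case: pickP => [y /= yw|/(_ x)]; last by rewrite /= !(eq_sym _ w) w_x.
  congr Some; case/orP: w_x yw => /eqP-> /orP[]/eqP.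
  - exact: fi_inj.
  - by move=> e; have := fi_fo x y; rewrite e eqxx.
  - by move=> e; have := fi_fo y x; rewrite e eqxx.
  - exact: fo_inj.
rewrite -(card_imset _ (fun x y : X => @Some_inj _ x y)).
apply: leq_trans (leq_imset_card h F); apply: subset_leq_card.
apply/subsetP=> _ /imsetP[x + ->]; rewrite inE => /existsP[u /orP[]] uF.
  by rewrite -(hE x u (fi x)) ?eqxx //; exact: imset_f.
by rewrite -(hE x u (fo x)) ?eqxx ?orbT //; exact: imset_f.
Qed.

Lemma MCut_ge C : (forall F : {set X}, #|F| < C -> exists x p,
    [/\ path r x p, dm x (last x p) & all (fun y => y \notin F) (x :: p)]) ->
  C <= MCut net_edges net_demands.
Proof.
move=> surv.
have key (F : {set 'I_N * 'I_N}) : F \subset net_edges ->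
    is_multicut net_edges net_demands F -> C <= #|F|.
  move=> _ cutF; rewrite leqNgt; apply/negP => FC.
  have [x [p [px dx /= /andP[xF pF]]]] := surv _ (leq_ltn_trans (card_hit_nodes F) FC).
  have dF : (fi x, fo (last x p)) \in net_demands.
    by rewrite inE; apply/existsP; exists x; apply/existsP; exists (last x p); rewrite dx eqxx.
  move/forallP: cutF => /(_ (fi x, fo (last x p))); rewrite dF /= => /negP[].
  pose e := [rel u w | (u, w) \in net_edges :\: F].
  have inner y : y \notin hit_nodes F -> connect e (fi y) (fo y).
    rewrite inE negb_exists => /forallP /(_ (fi y)); rewrite negb_or => /andP[_ yF].
    apply: connect1; rewrite /= !inE yF /=; apply/orP; left.
    by apply/existsP; exists y.
  elim: p x px {dx dF} xF pF => [|y p IH] x /=; first by move=> _ xF _; exact: inner.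
  case/andP=> xy py xF /andP[yF pF]; apply: connect_trans (inner _ xF) _.
  apply: connect_trans (IH y py yF pF); apply: connect1.
  have := yF; rewrite inE negb_exists => /forallP /(_ (fo x)); rewrite negb_or => /andP[xyF _].
  rewrite /= !inE xyF /=; apply/orP; right; apply/existsP; exists x; apply/existsP; exists y.
  by rewrite xy eqxx.
rewrite /MCut; apply: (big_ind (fun m => C <= m)).
(* The default value [#|E|] of the minimum is covered too: the full edge set is a multicut, as
   demands have distinct ends. *)
- apply: key => //; apply/forallP => p; apply/implyP => /net_demands_neq pp.
  apply/negP => /connectP[[|z q] /=]; first by move=> _ pe; rewrite pe eqxx in pp.
  by rewrite setDv inE.
- by move=> a b Ca Cb; rewrite leq_min Ca.
- by move=> F /andP[]; exact: key.
Qed.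

(** * Distances in the split network *)

Fixpoint ball (x : X) (k : nat) : {set X} :=
  if k is k'.+1 then ball x k' :|: [set z | [exists y in ball x k', r y z]] else [set x].

Lemma ball_path x k z : z \in ball x k ->
  exists p, [/\ path r x p, last x p = z & size p <= k].
Proof.
elim: k z => [|k IH] z /=; first by rewrite inE => /eqP->; exists [::].
rewrite inE => /orP[/IH[p [px lp sp]]|]; first by exists p; rewrite ltnW.
rewrite inE => /existsP[y /andP[/IH[p [px lp sp]] yz]].
by exists (rcons p z); rewrite rcons_path px lp yz last_rcons size_rcons.
Qed.

Lemma ball0 x k : x \in ball x k.
Proof. by elim: k => [|k IH] /=; rewrite inE ?IH. Qed.

(** Only node edges count. Reaching [fi z] crosses one node edge per arc from [x] to [z]; reaching
    [fo z] also crosses that of [z], whence the predecessor. *)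
Definition reach x k (u : 'I_N) : bool :=
  [exists z, (fi z == u) && (z \in ball x k)] ||
  [exists z, [&& fo z == u, 0 < k & z \in ball x k.-1]].

Lemma reach_fi x k z : reach x k (fi z) = (z \in ball x k).
Proof.
rewrite /reach; apply/orP/idP => [[/existsP[y /andP[/eqP/fi_inj-> //]]|]|zk].
  by case/existsP=> y /andP[/eqP e]; have := fi_fo z y; rewrite e eqxx.
by left; apply/existsP; exists z; rewrite eqxx.
Qed.

Lemma reach_fo x k z : reach x k (fo z) = (0 < k) && (z \in ball x k.-1).
Proof.
rewrite /reach; apply/orP/idP => [[]|zk].
- by case/existsP=> y /andP[/eqP e]; have := fi_fo y z; rewrite e eqxx.
- by case/existsP=> y /andP[/eqP/fo_inj->].
- by right; apply/existsP; exists z; rewrite eqxx.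
Qed.

(* The distance from [fi x] to [u], truncated at [T], when only node edges have length 1. *)
Definition potential x u : nat := \sum_(k < T) ~~ reach x k u.

Lemma potential_source x : potential x (fi x) = 0.
Proof. by apply: big1 => k _; rewrite reach_fi ball0. Qed.

Lemma potential_sink x y :
  (forall p, path r x p -> last x p = y -> T <= (size p).+1) -> potential x (fo y) = T.
Proof.
move=> len; rewrite /potential (eq_bigr (fun=> 1)) ?sum1_card ?card_ord // => k _.
rewrite reach_fo; case: (val k) (ltn_ord k) => [|k'] //= kT.
case yb : (y \in ball x k') => //; have [p [px lp sp]] := ball_path yb.
have := leq_trans (len p px lp) (sp : size p < k'.+1).
by rewrite leqNgt kT.
Qed.

Lemma potential_edge x e : e \in net_edges ->
  potential x e.2 <= potential x e.1 + node_edge e.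
Proof.
rewrite inE => /orP[ne|]; last first.
  case/existsP=> y /existsP[z /andP[yz /eqP->]] /=; apply: leq_trans (leq_addr _ _).
  apply: leq_sum => k _; rewrite reach_fi reach_fo.
  case: (val k) => [|k'] /=; first by case: (_ \in _).
  case yb : (y \in ball x k') => /=; last by case: (_ \in _).
  rewrite leqn0 eqb0 negbK inE; apply/orP; right; rewrite inE; apply/existsP.
  by exists y; rewrite yb.
rewrite ne; case/existsP: ne => y /eqP->; rewrite /potential /=; case: (T) => [|t].
  by rewrite !big_ord0.
(* Level [k.+1] at [fo y] agrees with level [k] at [fi y], so the sums match after a shift, up to an
   initial term equal to 1. *)
rewrite big_ord_recl /= big_ord_recr /= addn1 -addnS addnC.
apply: leq_add; last by case: (~~ _).
by apply: leq_sum => k _; rewrite reach_fo reach_fi.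
Qed.

Lemma sum_node_edge : \sum_e node_edge e <= #|X|.
Proof.
have -> : \sum_e node_edge e = #|[set (fi x, fo x) | x in X]|.
  rewrite -sum1_card [RHS]big_mkcond /=; apply: eq_bigr => e _.
  have -> : (e \in [set (fi x, fo x) | x in X]) = node_edge e.
    apply/imsetP/existsP => [[x _ ->]|[x /eqP->]]; first by exists x.
    by exists x.
  by case: node_edge.
exact: leq_imset_card.
Qed.

End Network.

(** * Elementary bounds on the minimum multicut *)

Lemma MCut_le_card N (E P F : {set 'I_N * 'I_N}) :
  F \subset E -> is_multicut E P F -> MCut E P <= #|F|.
Proof.
move=> FE cF; rewrite /MCut; have : F \in index_enum {set 'I_N * 'I_N} by rewrite mem_index_enum.
elim: (index_enum _) => [|G l IH] //; rewrite inE big_cons => /orP[/eqP<-|/IH le].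
  by rewrite FE cF geq_minl.
by case: ifP => // _; apply: leq_trans (geq_minr _ _) le.
Qed.

Lemma MCut_le_edges N (E P : {set 'I_N * 'I_N}) : MCut E P <= #|E|.
Proof.
apply: (big_ind (fun m => m <= #|E|)) => // [a b aE _|F /andP[FE _]].
  by apply: leq_trans aE; exact: geq_minl.
exact: subset_leq_card.
Qed.

Lemma MCut_gt0_path N (E P : {set 'I_N * 'I_N}) : 0 < MCut E P ->
  exists p q, [/\ p \in P, path [rel x y | (x, y) \in E] p.1 q, last p.1 q = p.2 & size q < N].
Proof.
move=> cut0; have : ~~ is_multicut E P set0.
  by apply: contraL cut0 => /(MCut_le_card (sub0set _)); rewrite cards0 lt0n negbK leqn0.
rewrite negb_forall => /existsP[p]; rewrite negb_imply negbK => /andP[pP /connectP[q]].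
rewrite setD0 => /shortenP[q' pq' uq' _ lq']; exists p, q'; split=> //.
by have := card_uniqP uq'; have := max_card (mem (p.1 :: q')); rewrite card_ord => le /= <-.
Qed.

(** * Multicommodity flows *)

From mathcomp Require Import all_classical all_reals all_analysis.
Import Order.TTheory GRing.Theory Num.Theory.
Local Open Scope ring_scope.

Section Flow.
Variables (R : realType) (N : nat).
Implicit Types (g : 'I_N * 'I_N -> R) (d : 'I_N -> R) (E P : {set 'I_N * 'I_N}).

Lemma sum_pairE (G : 'I_N * 'I_N -> R) : \sum_e G e = \sum_u \sum_v G (u, v).
Proof. by rewrite pair_bigA; apply: eq_bigr => -[u v] _. Qed.

Lemma sum_potential g d :
  \sum_e g e * (d e.2 - d e.1) = \sum_v d v * (inflow g v - outflow g v).
Proof.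
transitivity (\sum_e g e * d e.2 - \sum_e g e * d e.1).
  by rewrite -sumrB; apply: eq_bigr => e _; rewrite mulrBr.
rewrite !sum_pairE exchange_big /= -sumrB; apply: eq_bigr => v _.
by rewrite mulrBr /inflow /outflow !mulr_sumr; congr (_ - _); apply: eq_bigr => u _; rewrite mulrC.
Qed.

(** Summation by parts: inner nodes are balanced, [d s] vanishes, and total divergence zero makes
    the net inflow at [t] equal to the flow value. *)
Lemma flow_value_potential g d s t : s != t ->
  (forall v, v != s -> v != t -> inflow g v = outflow g v) -> d s = 0 ->
  \sum_e g e * (d e.2 - d e.1) = d t * flow_value g s.
Proof.
move=> st cons ds; rewrite sum_potential (bigD1 t) //= [X in _ + X]big1 ?addr0; last first.
  move=> v vt; have [->|vs] := eqVneq v s; first by rewrite ds mul0r.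
  by rewrite cons // subrr mulr0.
congr (_ * _); have : \sum_v (inflow g v - outflow g v) = 0.
  by rewrite sumrB /inflow /outflow exchange_big /= subrr.
rewrite (bigD1 t) //= (bigD1 s) //= [X in _ + (_ + X)]big1 ?addr0; last first.
  by move=> v /andP[vt vs]; rewrite cons // subrr.
by move/eqP; rewrite addr_eq0 opprB => /eqP.
Qed.

Lemma flow_value_le g s : (forall e, 0 <= g e) -> flow_value g s <= \sum_e g e.
Proof.
move=> g0; rewrite sum_pairE (bigD1 s) //= /flow_value lerBlDr -addrA lerDl.
by rewrite addr_ge0 // sumr_ge0 // => v _; rewrite ?sumr_ge0.
Qed.

Lemma total_flow_le E P f (len : 'I_N * 'I_N -> R) : feasible_mcflow E P f ->
  (forall e, 0 <= len e) ->
  \sum_(p in P) \sum_e f p e * len e <= \sum_(e in E) len e.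
Proof.
case=> [f0 fE _ _ cap] len0; rewrite exchange_big /= [leLHS](bigID (mem E)) /=.
rewrite [X in _ + X]big1 ?addr0; last first.
  by move=> e eE; apply: big1 => p _; rewrite fE // mul0r.
apply: ler_sum => e eE; rewrite -mulr_suml -[leRHS]mul1r; apply: ler_wpM2r => //.
exact: cap.
Qed.

Lemma flow_value0 (v : 'I_N) : flow_value (fun=> 0) v = 0 :> R.
Proof. by rewrite /flow_value /inflow /outflow !big1 ?subr0. Qed.

Lemma zero_flow_feasible E P : feasible_mcflow E P (fun _ _ => 0 : R).
Proof.
split=> [p e|//|p v _ _ _|p _|e _].
- exact: lexx.
- by rewrite /inflow /outflow !big1.
- by rewrite flow_value0.
- by rewrite big1.
Qed.

(** Weak duality: if the edge lengths put every demand at distance [T], each unit of flow consumes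
    at least [T] of the total length [B]. *)
Lemma MMFlow_le E P (len : 'I_N * 'I_N -> R) (T B : R) : 0 < T ->
  (forall e, 0 <= len e) -> \sum_(e in E) len e <= B ->
  (forall p, p \in P -> p.1 != p.2 /\ exists d : 'I_N -> R,
     [/\ d p.1 = 0, d p.2 = T & forall e, e \in E -> d e.2 <= d e.1 + len e]) ->
  MMFlow R E P <= B / T.
Proof.
move=> T0 len0 lenB HP; apply: ge_sup.
  by exists 0; exists (fun _ _ => 0); split; [exact: zero_flow_feasible|];
     rewrite big1 // => p _; exact: flow_value0.
move=> _ [f [ff ->]]; rewrite ler_pdivlMr // mulr_suml.
apply: le_trans lenB; apply: le_trans (total_flow_le ff len0).
have [f0 fE cons _ _] := ff; apply: ler_sum => p pP.
have [pp [d [ds dt dE]]] := HP p pP.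
rewrite mulrC -dt -(flow_value_potential pp (fun v => cons p v pP) ds); apply: ler_sum => e _.
have [eE|eE] := boolP (e \in E); last by rewrite fE // !mul0r.
by apply: ler_wpM2l => //; rewrite lerBlDl dE.
Qed.

Lemma MMFlow_ub E P f : feasible_mcflow E P f ->
  \sum_(p in P) flow_value (f p) p.1 <= MMFlow R E P.
Proof.
move=> ff; apply: sup_ubound; last by exists f.
exists (\sum_(e in E) 1) => _ [f' [ff' ->]].
apply: le_trans (total_flow_le ff' (fun=> ler01)); apply: ler_sum => p _.
have [f0 _ _ _ _] := ff'; apply: le_trans (flow_value_le _ (f0 p)) _.
by apply: ler_sum => e _; rewrite mulr1.
Qed.

Lemma MMFlow_ge0 E P : 0 <= MMFlow R E P.
Proof.
apply: le_trans (MMFlow_ub (zero_flow_feasible E P)).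
by rewrite big1 // => p _; exact: flow_value0.
Qed.

Definition walk_flow (x : 'I_N) q (e : 'I_N * 'I_N) : R := (count_mem e (zip (x :: q) q))%:R.

Lemma walk_flow_divergence x q v :
  outflow (walk_flow x q) v - inflow (walk_flow x q) v = (v == x)%:R - (v == last x q)%:R.
Proof.
elim: q x => [|y q IH] x.
  by rewrite /outflow /inflow !big1 ?subrr.
have e u : walk_flow x (y :: q) u = (u == (x, y))%:R + walk_flow y q u.
  by rewrite /walk_flow /= natrD eq_sym.
rewrite /outflow /inflow; under eq_bigr do rewrite e.
under [X in _ - X]eq_bigr do rewrite e.
rewrite !big_split /= opprD addrACA IH.
have -> : \sum_w ((v, w) == (x, y))%:R = (v == x)%:R :> R.
  rewrite (bigD1 y) //= big1 ?addr0 ?xpair_eqE ?eqxx ?andbT // => w wy.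
  by rewrite xpair_eqE (negbTE wy) andbF.
have -> : \sum_w ((w, v) == (x, y))%:R = (v == y)%:R :> R.
  rewrite (bigD1 x) //= big1 ?addr0 ?xpair_eqE ?eqxx // => w wy.
  by rewrite xpair_eqE (negbTE wy).
by rewrite addrA subrK.
Qed.

(** One unit is sent along the walk and divided by its length, since the walk may repeat an edge up
    to [size q] times. *)
Lemma MMFlow_path E P p q : p \in P -> p.1 != p.2 ->
  path [rel x y | (x, y) \in E] p.1 q -> last p.1 q = p.2 -> (size q)%:R^-1 <= MMFlow R E P.
Proof.
move=> pP pp pq lq.
have q0 : 0 < (size q)%:R :> R.
  by rewrite ltr0n; case: q lq {pq} => //= e; rewrite e eqxx in pp.
pose f p' e : R := if p' == p then walk_flow p.1 q e / (size q)%:R else 0.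
have div v : outflow (f p) v - inflow (f p) v = ((v == p.1)%:R - (v == p.2)%:R) / (size q)%:R.
  rewrite /outflow /inflow; under eq_bigr do rewrite /f eqxx.
  under [X in _ - X]eq_bigr do rewrite /f eqxx.
  by rewrite -!mulr_suml -mulrBl -/(outflow (walk_flow p.1 q) v) -/(inflow (walk_flow p.1 q) v)
     walk_flow_divergence lq.
have z p' v : p' != p -> outflow (f p') v = 0 /\ inflow (f p') v = 0.
  move=> np; split; rewrite /outflow /inflow /f; apply: big1 => w _; by rewrite (negbTE np).
have val : flow_value (f p) p.1 = (size q)%:R^-1.
  by rewrite /flow_value div eqxx (negbTE pp) subr0 mul1r.
have -> : (size q)%:R^-1 = \sum_(p' in P) flow_value (f p') p'.1.
  rewrite (bigD1 p) //= val big1 ?addr0 // => p' /andP[_ np].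
  by rewrite /flow_value; have [-> ->] := z p' p'.1 np; rewrite subr0.
apply: MMFlow_ub; split.
- by move=> p' e; rewrite /f; case: eqP => // _; rewrite divr_ge0 ?ler0n // ltW.
- move=> p' e eE; rewrite /f; case: eqP => // _; rewrite /walk_flow (count_memPn _) ?mul0r //.
  apply: contra eE; elim: q (p.1) pq {lq q0 f div z val} => //= y q IH x /andP[xy /IH{}IH].
  by rewrite inE => /orP[/eqP->|].
- move=> p' v _ v1 v2; apply/eqP; rewrite eq_sym -subr_eq0; apply/eqP.
  have [e|np] := eqVneq p' p; last by have [-> ->] := z p' v np; rewrite subrr.
  by rewrite e div -e (negbTE v1) (negbTE v2) subrr mul0r.
- move=> p' _; have [->|np] := eqVneq p' p; first by rewrite val invr_ge0 ltW.
  by rewrite /flow_value; have [-> ->] := z p' p'.1 np; rewrite subr0.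
- move=> e _; rewrite (bigD1 p) //= big1 ?addr0; last first.
    by move=> p' /andP[_ np]; rewrite /f (negbTE np).
  rewrite /f eqxx ler_pdivrMr // mul1r ler_nat; apply: leq_trans (count_size _ _) _.
  by rewrite size_zip geq_minr.
Qed.

(** Ensures that [MCG] is a true minimum rather than its default 0. A cut has at most [N * N] edges,
    and when it is positive some demand has a path of length below [N], so the flow is at least
    [1 / N]. *)
Lemma MCG_bound_exists : exists k, MCG_bound R N k.
Proof.
exists (N * N * N)%N => E P neq.
have [cut0|cut0] := posnP (MCut E P).
  by rewrite cut0 mulr_ge0 ?ler0n ?MMFlow_ge0.
have [p [q [pP pq lq sq]]] := MCut_gt0_path cut0.
have sq0 : (0 < size q)%N by case: q lq {pq sq} => //= e; have := neq p pP; rewrite e eqxx.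
have le1 : (N%:R : R)^-1 <= MMFlow R E P.
  apply: le_trans (MMFlow_path pP (neq p pP) pq lq).
  by rewrite lef_pV2 ?posrE ?ltr0n ?ler_nat // ?(ltnW sq) // (leq_trans _ (ltnW sq)).
have leE : (MCut E P <= N * N)%N.
  apply: leq_trans (MCut_le_edges E P) _; apply: leq_trans (max_card _) _.
  by rewrite card_prod !card_ord.
apply: le_trans (ler_wpM2l (ler0n _ _) le1).
rewrite natrM mulfK ?ler_nat // pnatr_eq0 -lt0n; exact: leq_ltn_trans sq.
Qed.

Lemma MCGP : MCG_bound R N (MCG R N).
Proof.
rewrite /MCG; case: pselect => [h|[]]; first by case: ex_minnP => k /asboolP.
by have [k Hk] := MCG_bound_exists; exists k; apply/asboolP.
Qed.

End Flow.

(** The split network needs [2 * #|X|] of the [N] nodes. Its cut is at least [C], while node edges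
    of length one bound its flow by [#|X| / T]. *)
Lemma MCG_gap (R : realType) (N T C : nat) (X : finType) (r dm : rel X) :
  (2 * #|X| <= N)%N -> (0 < T)%N ->
  (forall x p, path r x p -> dm x (last x p) -> (T <= (size p).+1)%N) ->
  (forall F : {set X}, (#|F| < C)%N -> exists x p,
    [/\ path r x p, dm x (last x p) & all (fun y => y \notin F) (x :: p)]) ->
  (C * T <= MCG R N * #|X|)%N.
Proof.
move=> XN T0 len surv.
have lt1 (x : X) : (enum_rank x < N)%N.
  by apply: leq_trans (ltn_ord _) _; apply: leq_trans XN; rewrite leq_pmull.
have lt2 (x : X) : (#|X| + enum_rank x < N)%N.
  by apply: leq_trans XN; rewrite mul2n -addnn ltn_add2l ltn_ord.
pose fi x := Ordinal (lt1 x); pose fo x := Ordinal (lt2 x).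
have fi_inj : injective fi by move=> x y /(congr1 val) /= /val_inj /enum_rank_inj.
have fo_inj : injective fo by move=> x y /(congr1 val) /= /addnI /val_inj /enum_rank_inj.
have fi_fo x y : fi x != fo y.
  by rewrite -val_eqE /= neq_ltn; apply/orP; left; apply: leq_trans (ltn_ord _) (leq_addr _ _).
pose E := net_edges r fi fo; pose P := net_demands dm fi fo.
have cutC : (C <= MCut E P)%N by exact: MCut_ge.
have flow : MMFlow R E P <= #|X|%:R / T%:R.
  apply: (MMFlow_le (len := fun e => (node_edge fi fo e)%:R)).
  - by rewrite ltr0n.
  - by move=> e; rewrite ler0n.
  - rewrite -natr_sum ler_nat; apply: leq_trans (sum_node_edge fi fo).
    by rewrite [X in (_ <= X)%N](bigID (mem E)) /= leq_addr.
  move=> p pP; split; first exact: net_demands_neq pP.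
  move: pP; rewrite inE => /existsP[x /existsP[y /andP[dxy /eqP->]]] /=.
  exists (fun u => (potential T r fi fo x u)%:R); split.
  - by rewrite potential_source.
  - by rewrite potential_sink // => p' px lp; apply: (len x p') => //; rewrite lp.
  - by move=> e eE; rewrite -natrD ler_nat; exact: potential_edge.
have := @MCGP R N E P (@net_demands_neq _ _ dm fi fo fi_fo).
move=> bound; rewrite -(ler_nat R) !natrM -ler_pdivlMr ?ltr0n // -mulrA.
apply: le_trans (ler_wpM2l (ler0n _ _) flow); apply: le_trans bound.
by rewrite ler_nat.
Qed.

(** * Extremal path systems *)

Lemma singletons_girth n p (x : 'I_n) : girth_gt (nseq p [:: x]) None.
Proof.
move=> b _ [b0 [vs [qs [_ _ _ _]]]]; rewrite /prec nth_nseq; case: ifP => // _.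
by rewrite !inE => /and3P[/eqP-> /eqP->]; rewrite ltnn.
Qed.

Lemma ps_size_bound n (Pi : seq (seq 'I_n)) : path_system Pi -> (ps_size Pi <= n * size Pi)%N.
Proof.
rewrite /ps_size; elim: Pi => [|pi Pi IH] //= /andP[upi /IH le]; rewrite mulnS leq_add //.
by rewrite -(card_uniqP upi) -[X in (_ <= X)%N](card_ord n) max_card.
Qed.

Lemma beta_ge n p k (Pi : seq (seq 'I_n)) : path_system Pi -> size Pi = p ->
  girth_gt Pi k -> (ps_size Pi <= beta n p k)%N.
Proof.
move=> uPi szPi gPi; have lt : (ps_size Pi < (n * p).+1)%N by rewrite ltnS -szPi ps_size_bound.
by apply: (@leq_bigmax_cond _ _ _ (Ordinal lt)); apply/asboolP; exists Pi.
Qed.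

Lemma beta_attained n p (x : 'I_n) : exists Pi : seq (seq 'I_n),
  [/\ path_system Pi, size Pi = p, girth_gt Pi None & ps_size Pi = beta n p None].
Proof.
pose A (s : 'I_(n * p).+1) := `[< exists Pi : seq (seq 'I_n),
  [/\ path_system Pi, size Pi = p, girth_gt Pi None & ps_size Pi = s] >].
have [|s /asboolP[Pi [uPi szPi gPi sPi]] e] := @eq_bigmax_cond _ A (fun s => s : nat).
  have lt : (ps_size (nseq p [:: x]) < (n * p).+1)%N.
    rewrite ltnS -[X in (_ * X)%N](size_nseq p [:: x]); apply: ps_size_bound.
    by apply/allP => s /nseqP[->].
  apply/card_gt0P; exists (Ordinal lt); apply/asboolP; exists (nseq p [:: x]).
  by rewrite size_nseq; split=> //; [apply/allP => s /nseqP[->] | exact: singletons_girth].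
by exists Pi; split=> //; rewrite sPi -e.
Qed.

Lemma beta_ge_paths n p (x : 'I_n) : (p <= beta n p None)%N.
Proof.
have := @beta_ge n p None (nseq p [:: x]); rewrite size_nseq.
rewrite {1}/ps_size map_nseq sumn_nseq mul1n; apply=> //.
  by apply/allP => s /nseqP[->].
exact: singletons_girth.
Qed.

(** A single split node already forces a positive ratio; this settles the case where [beta] is only
    of order [n log n]. *)
Lemma MCG_gt0 (R : realType) N : (2 <= N)%N -> (0 < MCG R N)%N.
Proof.
move=> N2; have := @MCG_gap R N 1 1 unit (fun _ _ => true) (fun _ _ => true).
rewrite card_unit !muln1; apply=> // F; rewrite ltnS leqn0 cards_eq0 => /eqP->.
by exists tt, [::]; split=> //=; rewrite inE.
Qed.

Lemma beta_le_MCG (R : realType) : exists2 D, (0 < D)%N & forall n, (2 <= n)%N ->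
  (beta n n None <= D * (n * (trunc_log 2 n).+1 * MCG R (beta n n None)))%N.
Proof.
exists (16 * 696)%N; first by rewrite muln_gt0.
move=> n n2; have x : 'I_n by exact: Ordinal (ltnW n2).
have [Pi [uPi szPi gPi]] := beta_attained n x; have := beta_ge_paths n x.
set b := beta n n None; set t := trunc_log 2 n => nb sb.
have M0 : (0 < MCG R b)%N by apply: MCG_gt0; exact: leq_trans nb.
have [|||] := bridge_free_gap _ uPi szPi gPi; rewrite ?sb -/t.
- exact: ltnW.
- by apply: leq_trans nb; exact: ltnW.
- move=> le; apply: leq_trans le _; rewrite -[leqLHS]muln1 -[leqLHS]mul1n -!mulnA.
  by apply: leq_mul => //; rewrite !leq_mul2l M0 !orbT.
case=> X [r [dm [T [[X0 XN T0 bT] [len surv]]]]].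
(* Fewer than [(#|X| %/ 16).+1] removed nodes means [16 * #|F| <= #|X|], and 16 times this threshold
   is at least [#|X|], whence the factor 16. *)
have gap : ((#|X| %/ 16).+1 * T <= MCG R b * #|X|)%N.
  apply: (MCG_gap R XN T0 len) => F FC; apply: surv.
  by move: FC; rewrite ltnS leq_divRL // mulnC.
have TM : (T <= 16 * MCG R b)%N.
  rewrite -(leq_pmul2l X0); have X16 := ltnW (ltn_ceil #|X| (isT : (0 < 16)%N)).
  apply: leq_trans (leq_mul X16 (leqnn T)) _.
  by rewrite mulnAC [leqLHS]mulnC [leqRHS]mulnCA leq_mul2l /= (mulnC #|X|).
apply: leq_trans bT _; apply: leq_trans (leq_mul (leqnn _) TM) _.
by rewrite mulnCA -!mulnA.
Qed.

Theorem theorem5p2 (R : realType) :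
  exists c : R, 0 < c /\
  exists n0 : nat, forall n : nat, (n0 <= n)%N ->
    c * ((beta n n None)%:R / (n%:R * ln (n%:R : R)))
      <= ((MCG R (beta n n None))%:R : R).
Proof.
have l2 : 0 < ln (2 : R) by rewrite ln_gt0 // ltr1n.
have [D D0 leD] := beta_le_MCG R; rewrite -(ltr0n R) in D0.
exists (ln 2 / (2 * D%:R)); split; first by rewrite divr_gt0 // mulr_gt0.
exists 2%N => n n2; have := leD n n2.
set b := beta n n None; set t := trunc_log 2 n; set m := MCG R b => le.
have n0 : 0 < n%:R :> R by rewrite ltr0n ltnW.
have ln0 : 0 < ln (n%:R : R) by rewrite ln_gt0 // ltr1n.
(* For [n >= 2] the logarithm [t] is at least 1, so [t.+1 <= 2 * t]; this is the 2 in the constant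
   [ln 2 / (2 * D)]. *)
have tln : t.+1%:R * ln (2 : R) <= 2 * ln (n%:R : R).
  have t1 : (0 < t)%N by rewrite trunc_log_gt0.
  apply: (@le_trans _ _ (2 * (t%:R * ln 2))).
    by rewrite mulrA ler_pM2r // -natrM ler_nat; lia.
  rewrite ler_pM2l // mulr_natl -lnXn // ler_ln ?posrE ?exprn_gt0 //.
  by rewrite -natrX ler_nat trunc_logP // ltnW.
have leR : b%:R <= D%:R * (n%:R * t.+1%:R * m%:R) :> R by rewrite -!natrM ler_nat.
rewrite mulrA ler_pdivrMr ?mulr_gt0 //.
apply: (@le_trans _ _ (ln 2 / (2 * D%:R) * (D%:R * (n%:R * t.+1%:R * m%:R)))).
  by rewrite ler_pM2l // divr_gt0 // mulr_gt0.
have -> : ln 2 / (2 * D%:R) * (D%:R * (n%:R * t.+1%:R * m%:R)) =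
    (m%:R * n%:R / 2) * (t.+1%:R * ln 2) :> R by field; rewrite gt_eqF.
have -> : m%:R * (n%:R * ln n%:R) = (m%:R * n%:R / 2) * (2 * ln n%:R) :> R by field.
by apply: ler_wpM2l => //; rewrite divr_ge0 // mulr_ge0 // ler0n.
Qed.
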